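(* Let $X$ be a C*-algebra, identified with a C*-subalgebra of $\mathcal B(H)$ via its universal representation on the Hilbert space $H$, and let $\pi:X''=\widehat X\to\mathcal B(H)$ be the map defined in the context. Let $a,b\in\mathrm{Fin}({}^*X)$. There is $a_0\in\mathrm{Fin}({}^*X)$ with $a_0\approx a$ (and $a_0b\in\mathrm{Fin}({}^*X)$) such that $\pi(\widehat a)\pi(\widehat b)=\pi(\widehat{a_0b})$. Similarly, there is $b_0\in\mathrm{Fin}({}^*X)$ with $b_0\approx b$ (and $ab_0\in\mathrm{Fin}({}^*X)$) such that $\pi(\widehat a)\pi(\widehat b)=\pi(\widehat{ab_0})$. Moreover, $a_0$ (resp. $b_0$) can be chosen from the internal extension of a net converging to $\pi(\widehat a)$ (resp. $\pi(\widehat b)$) in the weak operator topology; i.e. there is a net $(x_i)_{i\in I}$ in $X$ converging to $\pi(\widehat a)$ (resp. $\pi(\widehat b)$) in the weak operator topology such that $a_0$ (resp. $b_0$) can be taken to be the term $x_k$, for some $k\in{}^*I$, of its nonstandard extension $(x_i)_{i\in{}^*I}$.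
   Context: Nonstandard setting: a fixed nonstandard extension $Y\mapsto{}^*Y$ of the standard mathematical universe satisfying the Transfer Principle and $\kappa$-saturation (every family of at most $\kappa$ internal sets with the finite intersection property has nonempty intersection), with $\kappa$ a sufficiently large uncountable cardinal (in particular exceeding the cardinalities of $X'$, $H$ and the index sets of the nets involved). For $r,s$ in ${}^*\mathbb{R}$ or ${}^*\mathbb{C}$, $r\approx s$ means $|r-s|<1/n$ for all $n\in\mathbb{N}$; if $r$ is finite (i.e. $|r|<n$ for some $n\in\mathbb{N}$), ${}^\circ r$ is its standard part; for infinite $r\ge0$ put ${}^\circ r=\infty$. $X'$, $X''$ are the Banach space dual and bidual of $X$. Weak nonstandard hull: $\mathrm{Fin}({}^*X):=\{x\in{}^*X:\sup_{\phi\in X',\|\phi\|\le1}{}^\circ|{}^*\phi(x)|<\infty\}$; for $x_1,x_2\in\mathrm{Fin}({}^*X)$, $x_1\approx x_2$ means ${}^*\phi(x_1)\approx{}^*\phi(x_2)$ for all $\phi\in X'$; $\mathfrak I:=\{x\in\mathrm{Fin}({}^*X):x\approx0\}$; $\widehat X:=\mathrm{Fin}({}^*X)/\mathfrak I$, $\widehat x:=x+\mathfrak I$, $\|\widehat x\|:=\sup\{{}^\circ|{}^*\phi(x)|:\phi\in X',\|\phi\|\le1\}$. $\widehat X$ is identified with $X''$ through the isometric isomorphism sending $\widehat x$ to the functional $\phi\mapsto{}^\circ({}^*\phi(x))$ on $X'$. The universal representation is the direct sum of the GNS representations over all states of $X$. Definition of $\pi$: for $a\in\mathrm{Fin}({}^*X)$,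 $\pi(\widehat a)$ is the bounded operator on $H$ such that for each $\rho\in H$, $\pi(\widehat a)(\rho)$ is the unique element of $H$ with $\langle\xi,\pi(\widehat a)(\rho)\rangle={}^\circ\langle{}^*\xi,a({}^*\rho)\rangle$ for all $\xi\in H$ (this depends only on $\widehat a$). Products $a_0b$, $ab_0$ are taken in ${}^*X$. The weak operator topology on $\mathcal B(H)$ is the weakest topology making all $x\mapsto\langle x(\xi),\rho\rangle$ ($\xi,\rho\in H$) continuous. *)

(* Defs.v *)
From HB Require Import structures.
From mathcomp Require Import all_boot all_order all_algebra.
From mathcomp Require Import sesquilinear.
From mathcomp Require Export complex.
From mathcomp Require Import all_classical all_reals all_analysis.

Set Implicit Arguments.
Unset Strict Implicit.
Unset Printing Implicit Defensive.

Import Order.TTheory GRing.Theory Num.Theory.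
Import numFieldNormedType.Exports.

Local Open Scope classical_set_scope.
Local Open Scope ring_scope.
Local Open Scope complex_scope.

(* The standard mathematical universe is the many-sorted structure whose sorts
   are all types (of a fixed universe level), with all elements as constants and
   all finitary relations as basic relations.  Since [set A], [A -> B], [A * B],
   ... are again sorts, first-order formulas over it are the usual
   bounded-quantifier formulas; elements of [star (set A)] are the internal
   subsets of [star A]. *)

Fixpoint env (s : Type -> Type) (G : seq Type) : Type :=
  if G is A :: G' then (s A * env s G')%type else unit.

Fixpoint env_map (s t : Type -> Type) (f : forall A, s A -> t A)
    (G : seq Type) : env s G -> env t G :=
  if G is A :: G' then fun e => (f A e.1, env_map f e.2) else id.

(* de Bruijn variables of sort A in the context G *)
Inductive var : seq Type -> Type -> Type :=
| VZ A G : var (A :: G) A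
| VS A B G : var G A -> var (B :: G) A.

Fixpoint lookup (s : Type -> Type) G A (v : var G A) : env s G -> s A :=
  match v with
  | VZ _ _ => fun e => e.1
  | VS _ _ _ v' => fun e => lookup v' e.2
  end.

Inductive vars (G : seq Type) : seq Type -> Type :=
| VNil : vars G [::]
| VCons A D : var G A -> vars G D -> vars G (A :: D).

Fixpoint lookups (s : Type -> Type) G D (vs : vars G D) (e : env s G) :
    env s D :=
  match vs with
  | VNil => tt
  | VCons _ _ v vs' => (lookup v e, lookups vs' e)
  end.

Inductive formula (G : seq Type) : Type :=
| FEq A : var G A -> var G A -> formula G
| FRel D : (env id D -> Prop) -> vars G D -> formula G
| FNot : formula G -> formula G
| FAnd : formula G -> formula G -> formula G
| FImp : formula G -> formula G -> formula G
| FAll A : formula (A :: G) -> formula G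
| FEx A : formula (A :: G) -> formula G.

Fixpoint holds (s : Type -> Type)
    (L : forall D, (env id D -> Prop) -> env s D -> Prop)
    G (f : formula G) : env s G -> Prop :=
  match f with
  | FEq _ x y => fun e => lookup x e = lookup y e
  | FRel _ P xs => fun e => L _ P (lookups xs e)
  | FNot g => fun e => ~ holds L g e
  | FAnd g h => fun e => holds L g e /\ holds L h e
  | FImp g h => fun e => holds L g e -> holds L h e
  | FAll A g => fun e => forall x : s A, holds L g (x, e)
  | FEx A g => fun e => exists x : s A, holds L g (x, e)
  end.

Record nonstandard_extension := NonstandardExtension {
  star : Type -> Type;
  std : forall A, A -> star A;
  srel : forall D, (env id D -> Prop) -> env star D -> Prop;
  transfer : forall G (f : formula G) (e : env id G),
    holds (fun _ P => P) f e <-> holds srel f (env_map std e)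
}.
Arguments std {n A} x.
Arguments srel {n D} P e.

Section Lifts.
Context {U : nonstandard_extension}.
Local Notation "'* A" := (star U A) (at level 8, A at level 8).

Definition srel2 A B (P : A -> B -> Prop) (x : '*A) (y : '*B) : Prop :=
  @srel U [:: A; B] (fun e => P e.1 e.2.1) (x, (y, tt)).

Definition smem A (x : '*A) (S : '*(set A)) : Prop :=
  srel2 (fun (a : A) (s : set A) => s a) x S.

Definition sgraph A B (f : A -> B) (x : '*A) (y : '*B) : Prop :=
  srel2 (fun a b => f a = b) x y.

Definition sgraph2 A B C (f : A -> B -> C) (x : '*A) (y : '*B) (z : '*C) :=
  @srel U [:: A; B; C] (fun e => f e.1 e.2.1 = e.2.2.1) (x, (y, (z, tt))).

Lemma sgraph_ex A B (f : A -> B) (x : '*A) : exists y, sgraph f x y.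
Proof.
pose F : formula [::] := FAll (FEx (@FRel [:: B; A] [:: A; B]
  (fun e => f e.1 = e.2.1)
  (VCons (VS B (VZ A [::])) (VCons (VZ B [:: A]) (VNil _))))).
have [+ _] := @transfer U [::] F tt.
by apply => a; exists (f a).
Qed.

Lemma sgraph2_ex A B C (f : A -> B -> C) (x : '*A) (y : '*B) :
  exists z, sgraph2 f x y z.
Proof.
pose F : formula [::] := FAll (FAll (FEx (@FRel [:: C; B; A] [:: A; B; C]
  (fun e => f e.1 e.2.1 = e.2.2.1)
  (VCons (VS C (VS B (VZ A [::]))) (VCons (VS C (VZ B [:: A]))
    (VCons (VZ C [:: B; A]) (VNil _))))))).
have [+ _] := @transfer U [::] F tt.
by apply => a b; exists (f a b).
Qed.

(* The extension *f of a function: by transfer, the lifted graph of f is the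
   graph of a function. *)
Definition sext A B (f : A -> B) (x : '*A) : '*B := sval (cid (sgraph_ex f x)).
Definition sext2 A B C (f : A -> B -> C) (x : '*A) (y : '*B) : '*C :=
  sval (cid (sgraph2_ex f x y)).

End Lifts.

(* Saturation for families of internal sets indexed by K, i.e. of cardinality
   at most the cardinality of K. *)
Definition saturated (U : nonstandard_extension) (K : Type) : Prop :=
  forall (A : Type) (S : K -> star U (set A)),
    (forall F : set K, finite_set F ->
       exists x : star U A, forall k, F k -> smem x (S k)) ->
    exists x : star U A, forall k, smem x (S k).

Definition card_lt (A B : Type) : Prop :=
  ([set: A] #<= [set: B])%card /\ ~ ([set: B] #<= [set: A])%card.

Section StandardPart.
Context {U : nonstandard_extension}.

(* For K = R[i] the order is the partial one, in which [`|z|] is real. *)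
Definition sless (K : numFieldType) (x y : star U K) : Prop :=
  srel2 (fun r s : K => r < s) x y.

Definition snear (K : numFieldType) (r s : star U K) : Prop :=
  forall n : nat,
    sless (sext2 (fun x y : K => `|x - y|) r s) (std (n.+1%:R^-1 : K)).

Definition sfinite (K : numFieldType) (r : star U K) : Prop :=
  exists n : nat, sless (sext (fun x : K => `|x|) r) (std (n%:R : K)).

Definition st (K : numFieldType) (r : star U K) : K :=
  xget 0 [set x : K | snear r (std x)].

(* used for r >= 0 only *)
Definition est (R : realType) (r : star U R) : \bar R :=
  if `[< sfinite r >] then (st r)%:E else +oo%E.

End StandardPart.

Section Operators.
Context {R : realType}.
Local Notation C := (R[i] : numFieldType).

Record bop (V W : normedModType C) := Bop {
  bop_fun :> {linear V -> W};
  bop_continuous : continuous bop_fun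
}.

HB.instance Definition _ (V W : normedModType C) := gen_eqMixin (bop V W).
HB.instance Definition _ (V W : normedModType C) := gen_choiceMixin (bop V W).

Section Constructions.
Variables V W Z : normedModType C.

Fact bop0_continuous : continuous (\0 : {linear V -> W}).
Proof. by move=> x; exact: cvg_cst. Qed.
Definition bop0 : bop V W := Bop bop0_continuous.

Fact bop_comp_continuous (S : bop W Z) (T : bop V W) : continuous (S \o T).
Proof.
by move=> x; apply: continuous_comp; exact: bop_continuous.
Qed.
Definition bop_comp (S : bop W Z) (T : bop V W) : bop V Z :=
  @Bop V Z (S \o T : {linear V -> Z}) (@bop_comp_continuous S T).

End Constructions.

(* Norms on modules over R[i] take their values in R[i]. *)
Definition rnorm (V : normedModType C) (x : V) : R := complex.Re `|x|.

Definition opnorm (V W : normedModType C) (T : bop V W) : \bar R :=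
  ereal_sup [set (rnorm (T x))%:E | x in [set x : V | `|x| <= 1]].

End Operators.

Definition top_dual (R : realType) (X : normedModType R[i]) : Type :=
  bop X (R[i] : numFieldType)^o.

(* The inner product is linear in its first argument. *)
Record hilbertType (R : realType) := HilbertType {
  hilbert_sort :> completeNormedModType R[i];
  inner : {dot hilbert_sort for Num.conj};
  inner_norm : forall x : hilbert_sort, `|x| ^+ 2 = inner x x
}.

(* not necessarily unital *)
Record cstarType (R : realType) := CstarType {
  cstar_sort :> completeNormedModType R[i];
  cmul : cstar_sort -> cstar_sort -> cstar_sort;
  cadj : cstar_sort -> cstar_sort;
  cmulA : associative cmul;
  cmul_linearl : forall y, linear (cmul^~ y);
  cmul_linearr : forall x, linear (cmul x);
  cmul_norm : forall x y, `|cmul x y| <= `|x| * `|y|;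
  cadjK : involutive cadj;
  cadj_antilinear : forall (z : R[i]) x y,
    cadj (z *: x + y) = Num.conj z *: cadj x + cadj y;
  cadjM : forall x y, cadj (cmul x y) = cmul (cadj y) (cadj x);
  cstar_norm : forall x, `|cmul (cadj x) x| = `|x| ^+ 2
}.

Section UniversalRepresentation.
Context {R : realType}.

Definition positive_functional (X : cstarType R) (phi : top_dual X) : Prop :=
  forall x : X, 0 <= phi (cmul (cadj x) x).

Definition state (X : cstarType R) : Type :=
  {phi : top_dual X | positive_functional phi /\ opnorm phi = 1%E}.

(* The space is the completion of the quotient of X by the left kernel
   {a | phi (a^* a) = 0}, for the inner product phi (b^* a), and [gns_vec] is
   the canonical map from X into it. *)
Record gns (X : cstarType R) (phi : top_dual X) := Gns {
  gns_space :> hilbertType R;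
  gns_vec : {linear X -> gns_space};
  gns_rep : X -> bop gns_space gns_space;
  gns_inner : forall a b : X,
    inner gns_space (gns_vec a) (gns_vec b) = phi (cmul (cadj b) a);
  gns_dense : dense (range gns_vec);
  gns_act : forall x a : X, gns_rep x (gns_vec a) = gns_vec (cmul x a)
}.

(* The Hilbert direct sum of the GNS representations over all states, given by
   its canonical injections. *)
Record universal_rep (X : cstarType R) := UniversalRep {
  univ_space :> hilbertType R;
  univ_rep : X -> bop univ_space univ_space;
  univ_gns : forall phi : state X, gns (sval phi);
  univ_inj : forall phi : state X, {linear univ_gns phi -> univ_space};
  univ_isometry : forall (phi : state X) (u v : univ_gns phi),
    inner univ_space (univ_inj phi u) (univ_inj phi v)
      = inner (univ_gns phi) u v;
  univ_orthogonal : forall (phi psi : state X), phi <> psi ->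
    forall (u : univ_gns phi) (v : univ_gns psi),
      inner univ_space (univ_inj phi u) (univ_inj psi v) = 0;
  univ_dense : dense (range (fun s : seq {phi : state X & univ_gns phi} =>
    \sum_(p <- s) univ_inj (projT1 p) (projT2 p)));
  univ_act : forall (x : X) (phi : state X) (u : univ_gns phi),
    univ_rep x (univ_inj phi u) = univ_inj phi (gns_rep (univ_gns phi) x u)
}.

(* The weakest topology on B(H) making all maps T |-> <T xi, rho> continuous. *)
Definition wot (H : hilbertType R) : topologicalType :=
  sup_topology (fun p : H * H => Topological.on (initial_topology
    (fun T : bop H H => inner H (T p.1) p.2 : (R[i] : numFieldType)^o))).

End UniversalRepresentation.

Section WeakHull.
Context {R : realType} {U : nonstandard_extension}.

Definition weak_fin (X : normedModType R[i]) : set (star U X) :=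
  [set x | (ereal_sup [set est (sext (rnorm (V := (R[i] : numFieldType)^o))
                                     (sext (phi : X -> R[i]) x))
                      | phi in [set phi : top_dual X | opnorm phi <= 1]] < +oo)%E].

Definition weak_near (X : normedModType R[i]) (x1 x2 : star U X) : Prop :=
  forall phi : top_dual X,
    snear (K := R[i]) (sext (phi : X -> R[i]) x1) (sext (phi : X -> R[i]) x2).

Definition weak_infinitesimal (X : normedModType R[i]) : set (star U X) :=
  [set x | weak_fin x /\ weak_near x (std 0)].

(* The element of the hull represented by x: the coset of x modulo the
   weak infinitesimals. *)
Definition hat (X : normedModType R[i]) (x : star U X) : set (star U X) :=
  sext2 (fun y z : X => y + z) x @` @weak_infinitesimal X.

Definition weak_hull (X : normedModType R[i]) : set (set (star U X)) :=
  @hat X @` @weak_fin X.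

Definition smul (X : cstarType R) : star U X -> star U X -> star U X :=
  sext2 (cmul (c := X)).

Variables (X : cstarType R) (H : universal_rep X).

Definition sact (x : star U X) (xi : star U H) : star U H :=
  sext2 (fun (a : X) (h : H) => univ_rep H a h) x xi.

Definition sinner (xi rho : star U H) : star U R[i] :=
  sext2 (fun h k : H => inner H h k) xi rho.

(* Meant for c in [weak_hull X]. *)
Definition hull_pi (c : set (star U X)) : bop H H :=
  xget (bop0 H H) [set T : bop H H |
    forall a : star U X, weak_fin a -> hat a = c ->
    forall xi rho : H,
      inner H xi (T rho)
        = st (K := R[i]) (sinner (std xi) (sact a (std rho)))].

Definition directed (I : Type) (le : I -> I -> Prop) : Prop :=
  [/\ exists i : I, True,
      forall i, le i i,
      forall i j k, le i j -> le j k -> le i k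
    & forall i j, exists k, le i k /\ le j k].

Definition net_filter (I : Type) (le : I -> I -> Prop) : set_system I :=
  [set A | exists i, forall j, le i j -> A j].

(* c0 is a term of the nonstandard extension of a net in X that converges to T
   in the weak operator topology. *)
Definition term_of_wot_net (T : bop H H) (c0 : star U X) : Prop :=
  exists (I : Type) (le : I -> I -> Prop) (x : I -> X),
    [/\ directed le,
        (fun i => univ_rep H (x i) : wot H) @ net_filter le --> (T : wot H)
      & exists k : star U I, c0 = sext x k].

End WeakHull.

(* Main.v *)
From HB Require Import structures.
Require Import Defs.
From mathcomp Require Import all_boot all_order all_algebra.
From mathcomp Require Import sesquilinear ring lra.
From mathcomp Require Import all_classical all_reals all_analysis.

(** The idea is that both products are iterated limits.  A weakly finite
    point [a] of the nonstandard extension of [X] defines the functional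
    [A phi = st (phi a)] on [X'], that is an element of the bidual, and
    [pi (hat a)] is determined by the values of [A] at the vector functionals
    [vec_fun xi rho : x |-> <x rho, xi>].

    For weakly finite [a] and [b], the formula
    [theta phi (x) = st (phi (x b))] maps [X'] into itself ([arens_exists]),
    and [phi |-> A (theta phi)] is the first Arens product of the two elements
    of the bidual.  On a vector functional, passing to adjoints gives
    [theta (vec_fun xi rho) = vec_fun xi (pi (hat b) rho)], so
    [A (theta (vec_fun xi rho))] is the matrix coefficient
    [<pi (hat a) (pi (hat b) rho), xi>].  It is therefore enough to find [a0]
    with [phi (a0) ~ A phi] and [phi (a0 b) ~ A (theta phi)] for all [phi] in
    [X'].

    Index a net by the finite lists [i] of functionals, and let [x_i] in [X]
    satisfy [|phi (x_i) - A phi| < 1] for all [phi] in [i]; such a point exists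
    by transfer, because [a] satisfies these inequalities.  Since the conditions are imposed on all
    multiples of [phi], the fixed tolerance 1 yields convergence.  When the
    standard list [i] contains [phi] and [theta phi], the number
    [phi (x_i b)] is infinitely close to [theta phi (x_i)], hence at distance
    less than 1 from [A (theta phi)].  So the internal conditions
    [|phi (x_k) - A phi| < 1] and [|phi (x_k b) - A (theta phi)| < 1], one for
    each [phi], have the finite intersection property, and saturation gives one
    [k] for all of them ([iterated_limit]).  Both [x_k] and [x_k b] are weakly
    finite because [A] and [theta] are bounded.

    The second half is the same argument with the roles of [a] and [b]
    exchanged, [theta phi (x) = st (phi (a x))] and the other Arens product;
    [hull_pi_product] treats both at once for an arbitrary bilinear
    contraction [m].

    Three facts support this.  The nonstandard notions are translated into
    limits along the ultrafilter of the standard sets whose extension contains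
    a given internal point.  The operators [pi (hat a)] and the adjoints come
    from the Riesz representation theorem.  The vector functionals are
    continuous because the universal representation is contractive, which
    follows from the C*-identity by iterating the Cauchy-Schwarz inequality. *)

Set Implicit Arguments.
Unset Strict Implicit.
Unset Printing Implicit Defensive.

Import Order.TTheory GRing.Theory Num.Theory.
Import numFieldNormedType.Exports.

Local Open Scope classical_set_scope.
Local Open Scope ring_scope.
Local Open Scope complex_scope.
Local Notation Re := complex.Re.
Local Notation Im := complex.Im.

(** * The ultrafilter of an internal point *)

Section Transfer.
Context {U : nonstandard_extension}.

Local Notation v0 := (VZ _ _).
Local Notation v1 := (VS _ v0).
Local Notation v2 := (VS _ v1).
Local Notation v3 := (VS _ v2).
Local Notation rel1 P x := (@FRel _ [:: _] (fun e => P e.1) (VCons x (VNil _))).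
Local Notation rel2 P x y := (@FRel _ [:: _; _] (fun e => P e.1 e.2.1)
  (VCons x (VCons y (VNil _)))).
Local Notation rel3 P x y z := (@FRel _ [:: _; _; _]
  (fun e => P e.1 e.2.1 e.2.2.1) (VCons x (VCons y (VCons z (VNil _))))).

(** An ultrafilter on [T], the type of [z] over the standard universe.  A pair of internal points is
    the image of a single one under the projections ([spair_ex]), so every
    statement about finitely many internal points becomes one about the
    ultrafilter of one point. *)
Definition along T (z : star U T) : set_system T :=
  [set P | @srel U [:: T] (fun e => P e.1) (z, tt)].

Lemma along_std T (t : T) (P : set T) : along (std t) P <-> P t.
Proof.
exact: iff_sym (@transfer U [:: T] (rel1 P v0) (t, tt)).
Qed.

Lemma alongC T (z : star U T) (P : set T) : along z (~` P) <-> ~ along z P.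
Proof.
pose f : formula [::] := FAll (FAnd (FImp (rel1 (~` P) (VZ T _)) (FNot (rel1 P v0)))
   (FImp (FNot (rel1 P v0)) (rel1 (~` P) v0))).
have [+ _] := @transfer U [::] f tt.
by move=> /(_ (fun _ => conj id id)) /(_ z) /= [h1 h2]; split.
Qed.

Lemma along_sub T (z : star U T) (P Q : set T) :
  P `<=` Q -> along z P -> along z Q.
Proof.
move=> PQ.
pose f : formula [::] := FAll (FImp (rel1 P (VZ T _)) (rel1 Q v0)).
by have [+ _] := @transfer U [::] f tt; apply.
Qed.

Lemma alongI T (z : star U T) (P Q : set T) :
  along z P -> along z Q -> along z (P `&` Q).
Proof.
pose f : formula [::] := FAll (FImp (rel1 P (VZ T _)) (FImp (rel1 Q v0)
  (rel1 (P `&` Q) v0))).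
by have [+ _] := @transfer U [::] f tt; apply.
Qed.

Lemma alongT T (z : star U T) : along z setT.
Proof.
pose f : formula [::] := FAll (rel1 setT (VZ T _)).
by have [+ _] := @transfer U [::] f tt; apply.
Qed.

#[global] Instance along_proper T (z : star U T) : ProperFilter (along z).
Proof.
split.
  by have := alongT z; rewrite -setC0 => /alongC.
split; [exact: alongT|exact: alongI|exact: along_sub].
Qed.

Lemma sextP A B (f : A -> B) (x : star U A) : sgraph f x (sext f x).
Proof. exact: svalP. Qed.

Lemma sext2P A B C (f : A -> B -> C) (x : star U A) (y : star U B) :
  sgraph2 f x y (sext2 f x y).
Proof. exact: svalP. Qed.

Lemma sgraph_uniq A B (f : A -> B) (x : star U A) y :
  sgraph f x y -> y = sext f x.
Proof.
pose F : formula [::] := FAll (FAll (FAll (FImp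
  (rel2 (fun a b => f a = b) v2 (VZ B _)) (FImp
  (rel2 (fun a b => f a = b) v2 v1) (FEq v0 v1))))).
have [+ _] := @transfer U [::] F tt.
move/(_ _ x (sext f x) y) => h xy; apply: h => //; first by move=> ? ? ? /= <- <-.
exact: sextP.
Qed.

Lemma along_sext A B (f : A -> B) (x : star U A) (P : set B) :
  along (sext f x) P <-> along x (P \o f).
Proof.
pose F : formula [::] := FAll (FAll (FImp
  (rel2 (fun a b => f a = b) v1 (VZ B _)) (FAnd
  (FImp (rel1 P v0) (rel1 (P \o f) v1))
  (FImp (rel1 (P \o f) v1) (rel1 P v0))))).
have [+ _] := @transfer U [::] F tt.
move/(_ _ x (sext f x) (sextP f x)) => h; apply: h.
by move=> a b /= <-.
Qed.

(** The following three lemmas push a relation or an operation through points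
    that are images of a common [z], so that only standard functions on the
    sort of [z] remain. *)
Lemma srel2_sext T A B (P : A -> B -> Prop) (f : T -> A) (g : T -> B)
    (z : star U T) :
  srel2 P (sext f z) (sext g z) <-> along z [set t | P (f t) (g t)].
Proof.
pose F : formula [::] := FAll (FAll (FAll (FImp
  (rel2 (fun a b => f a = b) v2 v1) (FImp
  (rel2 (fun a b => g a = b) v2 (VZ B _)) (FAnd
  (FImp (rel2 P v1 v0) (rel1 (fun t => P (f t) (g t)) v2))
  (FImp (rel1 (fun t => P (f t) (g t)) v2) (rel2 P v1 v0))))))).
have [+ _] := @transfer U [::] F tt.
move/(_ _ z (sext f z) (sext g z) (sextP f z) (sextP g z)) => h; apply: h.
by move=> t a b /= <- <-.
Qed.

Lemma sext_comp T A B (f : T -> A) (g : A -> B) (z : star U T) :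
  sext g (sext f z) = sext (g \o f) z.
Proof.
apply: sgraph_uniq.
pose F : formula [::] := FAll (FAll (FAll (FImp
  (rel2 (fun a b => f a = b) v2 v1) (FImp
  (rel2 (fun a b => g a = b) v1 (VZ B _))
  (rel2 (fun a b => (g \o f) a = b) v2 v0))))).
have [+ _] := @transfer U [::] F tt.
move/(_ _ z _ (sext g (sext f z)) (sextP f z) (sextP g _)) => h; apply: h.
by move=> t a b /= <- <-.
Qed.

Lemma sext2_sext T A B C (h : A -> B -> C) (f : T -> A) (g : T -> B)
    (z : star U T) :
  sext2 h (sext f z) (sext g z) = sext (fun t => h (f t) (g t)) z.
Proof.
apply: sgraph_uniq.
pose F : formula [::] := FAll (FAll (FAll (FAll (FImp
  (rel2 (fun a b => f a = b) v3 v2) (FImp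
  (rel2 (fun a b => g a = b) v3 v1) (FImp
  (rel3 (fun a b c => h a b = c) v2 v1 (VZ C _))
  (rel2 (fun t c => h (f t) (g t) = c) v3 v0))))))).
have [+ _] := @transfer U [::] F tt.
move/(_ _ z _ _ (sext2 h (sext f z) (sext g z)) (sextP f z) (sextP g z)
  (sext2P h _ _)) => H; apply: H.
by move=> t a b c /= <- <- <-.
Qed.

Lemma sext_id T (z : star U T) : sext id z = z.
Proof.
apply/esym/sgraph_uniq.
pose F : formula [::] := FAll (rel2 (fun a b : T => id a = b) v0 v0).
have [+ _] := @transfer U [::] F tt; exact.
Qed.

Lemma sext_cst T A (a : A) (z : star U T) : sext (fun=> a) z = std a.
Proof.
apply/esym/sgraph_uniq.
pose F : formula [:: A] := FAll (rel2 (fun (_ : T) b => a = b) v0 v1).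
have [+ _] := @transfer U [:: A] F (a, tt); exact.
Qed.

Lemma spair_ex A B (x : star U A) (y : star U B) :
  exists z : star U (A * B), x = sext fst z /\ y = sext snd z.
Proof.
pose F : formula [::] := FAll (FAll (FEx (FAnd
  (rel2 (fun a b => fst a = b) (VZ (A * B)%type _) v2)
  (rel2 (fun a b => snd a = b) (VZ (A * B)%type _) v1)))).
have [+ _] := @transfer U [::] F tt.
case/(_ _)/(_ x y) => [a b /=|z /= [/sgraph_uniq ? /sgraph_uniq ?]].
  by exists (a, b).
by exists z.
Qed.

End Transfer.

(** * Real-valued norms over the complex numbers *)

Section RealNorm.
Context {R : realType}.
Local Notation C := (R[i] : numFieldType).
Local Notation cabs := (rnorm (V := C^o)).

Lemma normE (V : normedModType C) (x : V) : `|x| = (rnorm x)%:C.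
Proof. by rewrite /rnorm RRe_real// normr_real. Qed.

Lemma rnorm_ge0 (V : normedModType C) (x : V) : 0 <= rnorm x.
Proof. by rewrite -ler0c -normE. Qed.

Lemma rnorm0 (V : normedModType C) : rnorm (0 : V) = 0.
Proof. by rewrite /rnorm normr0. Qed.

Lemma rnorm0_eq0 (V : normedModType C) (x : V) : rnorm x = 0 -> x = 0.
Proof. by move=> x0; apply/normr0_eq0; rewrite normE x0. Qed.

Lemma rnormN (V : normedModType C) (x : V) : rnorm (- x) = rnorm x.
Proof. by rewrite /rnorm normrN. Qed.

Lemma rnormBC (V : normedModType C) (x y : V) : rnorm (x - y) = rnorm (y - x).
Proof. by rewrite /rnorm distrC. Qed.

Lemma ler_rnormD (V : normedModType C) (x y : V) :
  rnorm (x + y) <= rnorm x + rnorm y.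
Proof. by rewrite -lecR rmorphD /= -!normE ler_normD. Qed.

Lemma ler_rnorm_dist (V : normedModType C) (x y z : V) :
  rnorm (x - z) <= rnorm (x - y) + rnorm (y - z).
Proof. by have := ler_rnormD (x - y) (y - z); rewrite addrA subrK. Qed.

Lemma rnormZ (V : normedModType C) (z : C) (x : V) :
  rnorm (z *: x) = cabs z * rnorm x.
Proof. by apply: complexI; rewrite rmorphM /= -!normE normrZ. Qed.

Lemma cabsM (z w : C) : cabs (z * w) = cabs z * cabs w.
Proof. exact: (@rnormZ C^o). Qed.

Lemma cabs_real (r : R) : cabs r%:C = `|r|.
Proof. by rewrite /rnorm normc_def /= expr0n /= addr0 sqrtr_sqr. Qed.

Lemma cabs_conj (z : C) : cabs (Num.conj z) = cabs z.
Proof. by rewrite /rnorm norm_conjC. Qed.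

Lemma Re_le_cabs (z : C) : `|Re z| <= cabs z.
Proof.
rewrite /rnorm normc_def /= -sqrtr_sqr ler_wsqrtr //.
by rewrite lerDl sqr_ge0.
Qed.

Lemma cabs_sqr (z : C) : cabs z ^+ 2 = Re z ^+ 2 + Im z ^+ 2.
Proof.
by rewrite /rnorm normc_def /= sqr_sqrtr // addr_ge0 ?sqr_ge0.
Qed.

Lemma cabs_sqrC (z : C) : (cabs z ^+ 2)%:C = z * Num.conj z.
Proof. by rewrite rmorphXn /= -normE; exact: normCK. Qed.

Lemma cabs_le_ReIm (z : C) : cabs z <= `|Re z| + `|Im z|.
Proof.
rewrite -(@ler_pXn2r _ 2) ?nnegrE ?rnorm_ge0 ?addr_ge0 //.
rewrite cabs_sqr sqrrD !real_normK ?num_real // lerD2r.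
by rewrite lerDl mulrn_wge0 // mulr_ge0.
Qed.

End RealNorm.

(** * Limits along an internal point *)

Section Ultralimits.
Context {R : realType} {U : nonstandard_extension}.
Local Notation C := (R[i] : numFieldType).
Local Notation cabs := (rnorm (V := C^o)).

Lemma snear_alongE (K : numFieldType) T (f g : T -> K) (z : star U T) :
  snear (sext f z) (sext g z) <->
  forall n, along z [set t | `|f t - g t| < n.+1%:R^-1].
Proof.
split=> h n; have := h n; rewrite /sless sext2_sext -(sext_cst _ z).
  by move/srel2_sext.
by move=> ?; apply/srel2_sext.
Qed.

Lemma snearC T (f g : T -> R[i]) (z : star U T) :
  snear (K := C) (sext f z) (sext g z) <->
  forall e, 0 < e -> along z [set t | cabs (f t - g t) < e].
Proof.
have nC n : n.+1%:R^-1 = (n.+1%:R^-1 : R)%:C.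
  by rewrite fmorphV rmorph_nat.
rewrite snear_alongE; split=> [h e e0|h n].
  have [n ne] : exists n, n.+1%:R^-1 < e.
    exists (Num.truncn e^-1); rewrite invf_plt ?posrE //.
    by have := truncnS_gt e^-1.
  apply: along_sub (h n) => t /=; rewrite nC normE ltcR.
  by move/lt_trans; apply.
apply: along_sub (h n.+1%:R^-1 _) => [t /=|]; last by rewrite invr_gt0.
by rewrite nC normE ltcR.
Qed.

Lemma snearR T (f g : T -> R) (z : star U T) :
  snear (sext f z) (sext g z) <->
  forall e, 0 < e -> along z [set t | `|f t - g t| < e].
Proof.
rewrite snear_alongE; split=> [h e e0|h n].
  have [n ne] : exists n, n.+1%:R^-1 < e.
    exists (Num.truncn e^-1); rewrite invf_plt ?posrE //.
    by have := truncnS_gt e^-1.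
  apply: along_sub (h n) => t /=.
  by move/lt_trans; apply.
by apply: along_sub (h n.+1%:R^-1 _) => [t //|]; rewrite invr_gt0.
Qed.

(** The limit is the supremum of the lower bounds that hold along [z]; it is the
    dichotomy of an ultrafilter that turns failure of a lower bound into an
    upper bound. *)
Lemma along_bounded_limit T (f : T -> R) (z : star U T) (M : R) :
  along z [set t | `|f t| <= M] ->
  exists l, forall e, 0 < e -> along z [set t | `|f t - l| < e].
Proof.
move=> fM; pose S := [set r | along z [set t | r <= f t]].
have S0 : S !=set0.
  by exists (- M); apply: along_sub fM => t /=; rewrite ler_norml => /andP[].
have Su : ubound S M.
  move=> r Sr; have [t /= [rt tM]] := filter_ex (alongI Sr fM).
  by rewrite (le_trans rt) // (le_trans (ler_norm _)).
have hS : has_sup S by split=> //; exists M.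
exists (sup S) => e e0.
have [r Sr re] := sup_adherent e0 hS.
have nSe : ~ S (sup S + e / 2).
  move=> /(ub_le_sup (ex_intro _ M Su)); rewrite gerDl leNgt divr_gt0 //.
move/alongC in nSe; apply: along_sub (alongI Sr nSe) => t /= [rt /negP].
rewrite -ltNge => tS; rewrite ltr_distl (lt_le_trans re rt) /=.
by rewrite (lt_trans tS) // ltrD2l; lra.
Qed.

(** The standard part of the value at [z] of the extension of [f]; it is the limit
    of [f] along [z] when [f] is bounded along [z]. *)
Definition clim T (z : star U T) (f : T -> R[i]) : R[i] := st (K := C) (sext f z).

Lemma climP T (z : star U T) (f : T -> R[i]) (M : R) :
  along z [set t | cabs (f t) <= M] ->
  forall e, 0 < e -> along z [set t | cabs (f t - clim z f) < e].
Proof.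
move=> fM.
have [|l1 L1] := @along_bounded_limit T (fun t => Re (f t)) z M.
  by apply: along_sub fM => t /=; apply/le_trans/Re_le_cabs.
have [|l2 L2] := @along_bounded_limit T (fun t => Im (f t)) z M.
  apply: along_sub fM => t /=; apply: le_trans.
  by rewrite /rnorm normc_def /= -sqrtr_sqr ler_wsqrtr // lerDr sqr_ge0.
apply/snearC; rewrite sext_cst /clim /st.
apply: (@xgetPex _ 0 [set x : C | snear (sext f z) (std x)]).
exists (l1 +i* l2); rewrite /= -(sext_cst _ z); apply/snearC => e e0.
have e2 : 0 < e / 2 by rewrite divr_gt0.
apply: along_sub (alongI (L1 _ e2) (L2 _ e2)) => t /= [h1 h2].
apply: le_lt_trans (cabs_le_ReIm _) _; rewrite (splitr e).
by case: (f t) h1 h2 => x y /= h1 h2; rewrite ltrD.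
Qed.

Lemma along_near_uniq T (z : star U T) (f : T -> R[i]) (l l' : R[i]) :
  (forall e, 0 < e -> along z [set t | cabs (f t - l) < e]) ->
  (forall e, 0 < e -> along z [set t | cabs (f t - l') < e]) -> l = l'.
Proof.
move=> h h'; apply/eqP; rewrite -subr_eq0; apply/eqP/(@rnorm0_eq0 _ C^o).
apply/eqP; rewrite eq_le rnorm_ge0 andbT; apply/ler_addgt0Pr => e e0.
have e2 : 0 < e / 2 by rewrite divr_gt0.
have [t /= [h1 h2]] := filter_ex (alongI (h _ e2) (h' _ e2)).
have := @ler_rnorm_dist _ C^o l (f t) l'; rewrite add0r => /le_trans; apply.
by rewrite (splitr e) lerD // ltW // (@rnormBC _ C^o).
Qed.

Lemma clim_eq T (z : star U T) (f : T -> R[i]) (l : R[i]) :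
  (forall e, 0 < e -> along z [set t | cabs (f t - l) < e]) -> clim z f = l.
Proof.
move=> h.
apply: (@along_near_uniq T z f) => //.
apply: (@climP _ _ _ (cabs l + 1)).
apply: along_sub (h _ ltr01) => t /= tl.
have := @ler_rnormD _ C^o (f t - l) l; rewrite subrK => /le_trans; apply.
by rewrite addrC lerD2l ltW.
Qed.

Lemma clim_le T (z : star U T) (f : T -> R[i]) (M : R) :
  along z [set t | cabs (f t) <= M] -> cabs (clim z f) <= M.
Proof.
move=> fM; apply/ler_addgt0Pr => e e0.
have [t /= [h1 h2]] := filter_ex (alongI fM (climP fM e0)).
have := @ler_rnormD _ C^o (clim z f - f t) (f t); rewrite subrK => /le_trans.
by apply; rewrite addrC lerD // (@rnormBC _ C^o) ltW.
Qed.

Lemma clim_linear T (z : star U T) (f g : T -> R[i]) (k : R[i]) (M N : R) :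
  along z [set t | cabs (f t) <= M] -> along z [set t | cabs (g t) <= N] ->
  clim z (fun t => k * f t + g t) = k * clim z f + clim z g.
Proof.
move=> fM gN; apply: clim_eq => e e0.
have e2 : 0 < e / 2 by rewrite divr_gt0.
have k1 : 0 < cabs k + 1 by rewrite ltr_wpDl ?rnorm_ge0.
have e3 : 0 < e / 2 / (cabs k + 1) by rewrite divr_gt0.
apply: along_sub (alongI (climP fM e3) (climP gN e2)) => t /= [h1 h2].
rewrite (_ : _ - _ = k * (f t - clim z f) + (g t - clim z g)); last by ring.
apply: le_lt_trans (@ler_rnormD _ C^o _ _) _.
rewrite (splitr e) ltr_leD // ?ltW //.
rewrite cabsM; move: h1; rewrite ltr_pdivlMr // mulrC; apply: le_lt_trans.
by rewrite ler_wpM2r ?rnorm_ge0 // lerDl.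
Qed.

Lemma clim_conj T (z : star U T) (f : T -> R[i]) (M : R) :
  along z [set t | cabs (f t) <= M] ->
  clim z (fun t => Num.conj (f t)) = Num.conj (clim z f).
Proof.
move=> fM; apply: clim_eq => e e0.
apply: along_sub (climP fM e0) => t /=.
by rewrite -rmorphB cabs_conj.
Qed.

End Ultralimits.

(** * Bounded operators *)

Section BoundedOperators.
Context {R : realType}.
Local Notation C := (R[i] : numFieldType).

Lemma bop_eq (V W : normedModType C) (S T : bop V W) : S =1 T -> S = T.
Proof.
case: S T => [[f [[f1] [f2]]] cf] [[g [[g1] [g2]]] cg] /= fg.
have {}fg : f = g by apply/funext.
rewrite -{}fg in g1 g2 cg *.
rewrite (Prop_irrelevance f1 g1) (Prop_irrelevance f2 g2) in cf *.
by rewrite (Prop_irrelevance cf cg).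
Qed.

Lemma bop_bound (V W : normedModType C) (T : bop V W) :
  exists M, 0 <= M /\ forall x, rnorm (T x) <= M * rnorm x.
Proof.
have /linear_bounded_continuous/linear_boundedP := @bop_continuous _ _ _ T.
case/pinfty_ex_gt0 => r r0 h; exists (Re r); have rE : r = (Re r)%:C.
  by rewrite RRe_real ?gtr0_real.
rewrite rE ltcR in r0; split; first exact: ltW.
by move=> x; rewrite -lecR rmorphM /= -rE -!normE.
Qed.

Lemma bop_exists (V W : normedModType C) (f : V -> W) (M : R) : linear f ->
  (forall x, rnorm (f x) <= M * rnorm x) -> exists T : bop V W, T =1 f.
Proof.
move=> fl fM.
pose fL := GRing.isLinear.Build C V W _ f fl.
pose g : {linear V -> W} := HB.pack f fL.
have gc : continuous g.
  apply/linear_bounded_continuous/bounded_funP => r.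
  exists ((`|M| * Re r)%:C) => x; rewrite !normE => xr.
  rewrite lecR; apply: le_trans (fM x) _.
  have r0 : 0 <= r by apply: le_trans xr; rewrite ler0c rnorm_ge0.
  move: xr; rewrite -[r in _ <= r](RRe_real (ger0_real r0)) lecR => xr.
  apply: (@le_trans _ _ (`|M| * rnorm x)).
    by rewrite ler_wpM2r ?rnorm_ge0 // ler_norm.
  by rewrite ler_wpM2l.
by exists (Bop gc).
Qed.

Lemma opnorm_le1 (X : normedModType C) (phi : top_dual X) :
  (opnorm phi <= 1)%E <-> forall x, rnorm (phi x) <= rnorm x.
Proof.
split=> [h x|h]; last first.
  apply: ge_ereal_sup => _ [x x1 <-]; rewrite lee_fin.
  apply: le_trans (h x) _; move: x1 => /=.
  by rewrite -(rmorph1 (real_complex R)) normE lecR.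
have [x0|x0] := eqVneq (rnorm x) 0.
  by rewrite (rnorm0_eq0 x0) linear0 !rnorm0.
have xp : 0 < rnorm x by rewrite lt_def x0 rnorm_ge0.
pose y := (rnorm x)^-1%:C *: x.
have ny : rnorm y = 1.
  by rewrite /y rnormZ cabs_real ger0_norm ?invr_ge0 ?rnorm_ge0 // mulVf.
have : ((rnorm (phi y))%:E <= 1)%E.
  apply: le_trans h; apply: ereal_sup_ubound; exists y => //=.
  by rewrite normE ny rmorph1.
rewrite lee_fin /y linearZ /= cabsM cabs_real ger0_norm ?invr_ge0 ?rnorm_ge0 //.
by rewrite mulrC ler_pdivrMr // mul1r.
Qed.

End BoundedOperators.

(** * Inner products and the Riesz representation *)

Section Hilbert.
Context {R : realType}.
Local Notation C := (R[i] : numFieldType).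
Local Notation cabs := (rnorm (V := C^o)).
Variable H : hilbertType R.
Local Notation "''[' x , y ]" := (inner H x y).
Implicit Types x y z : H.

Lemma innerDl x y z : '[x + y, z] = '[x, z] + '[y, z].
Proof. exact: linearDl. Qed.
Lemma innerDr x y z : '[z, x + y] = '[z, x] + '[z, y].
Proof. exact: linearDr. Qed.
Lemma innerZl (k : C) x y : '[k *: x, y] = k * '[x, y].
Proof. exact: linearZl_LR. Qed.
Lemma innerZr (k : C) x y : '[x, k *: y] = Num.conj k * '[x, y].
Proof. exact: linearZr_LR. Qed.
Lemma innerBl x y z : '[x - y, z] = '[x, z] - '[y, z].
Proof. exact: linearBl. Qed.
Lemma innerBr x y z : '[z, x - y] = '[z, x] - '[z, y].
Proof. exact: linearBr. Qed.
Lemma inner_conj x y : Num.conj '[x, y] = '[y, x].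
Proof. by rewrite [RHS]hermC /= expr0 mul1r. Qed.

Lemma inner_rnorm x : '[x, x] = (rnorm x ^+ 2)%:C.
Proof. by rewrite -inner_norm normE rmorphXn. Qed.

(** The squared norm of [n x - <x, y> y], where [n] is the squared norm of [y],
    is [n] times the defect of the squared inequality. *)
Lemma cauchy_schwarz x y : cabs '[x, y] <= rnorm x * rnorm y.
Proof.
have [y0|y0] := eqVneq (rnorm y) 0.
  rewrite (rnorm0_eq0 y0) (_ : '[x, 0] = 0) ?rnorm0 ?mulr0 //.
  exact: linear0r.
have yp : 0 < rnorm y by rewrite lt_def y0 rnorm_ge0.
rewrite -(@ler_pXn2r _ 2) ?nnegrE ?mulr_ge0 ?rnorm_ge0 //.
rewrite exprMn.
pose n := (rnorm y ^+ 2); pose c := '[x, y].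
have np : 0 < n by rewrite exprn_gt0.
have : (rnorm (n%:C *: x - c *: y) ^+ 2)%:C =
   (n * (n * rnorm x ^+ 2 - cabs c ^+ 2))%:C.
  rewrite -inner_rnorm innerBl !innerBr !innerZl !innerZr !inner_rnorm.
  rewrite -(inner_conj x y) -/c -/n.
  have -> : (n * (n * rnorm x ^+ 2 - cabs c ^+ 2))%:C =
      n%:C * (n%:C * (rnorm x ^+ 2)%:C - (cabs c ^+ 2)%:C).
    by rewrite -rmorphM -rmorphB -rmorphM.
  rewrite cabs_sqrC.
  rewrite (_ : Num.conj n%:C = n%:C); last first.
    by rewrite -[RHS]conj_Creal ?complex_real //.
  ring.
move/complexI => e.
have : 0 <= n * (n * rnorm x ^+ 2 - cabs c ^+ 2) by rewrite -e sqr_ge0.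
by rewrite pmulr_rge0 // subr_ge0 mulrC.
Qed.

Lemma rnormD_sqr x y :
  rnorm (x + y) ^+ 2 = rnorm x ^+ 2 + rnorm y ^+ 2 + 2 * Re '[x, y].
Proof.
have := inner_rnorm (x + y).
rewrite innerDl !innerDr !inner_rnorm -(inner_conj x y).
case: '[x, y] => a b /(congr1 (@complex.Re R)) /= <-; ring.
Qed.

Lemma inner_eq x y : (forall z, '[z, x] = '[z, y]) -> x = y.
Proof.
move=> h; apply/eqP; rewrite -subr_eq0; apply/eqP/rnorm0_eq0/eqP.
rewrite -sqrf_eq0; apply/eqP/complexI; rewrite -inner_rnorm innerBr h.
by rewrite subrr.
Qed.

End Hilbert.

Section Riesz.
Context {R : realType}.
Local Notation C := (R[i] : numFieldType).
Local Notation cabs := (rnorm (V := C^o)).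
Variable H : hilbertType R.
Local Notation "''[' x , y ]" := (inner H x y).
Variables (f : H -> C^o) (M : R).
Hypotheses (f_linear : linear f) (f_bound : forall x, cabs (f x) <= M * rnorm x).

(* With [f v = <v, y>] this is the squared norm of [x - y], up to a constant. *)
Let J x := rnorm x ^+ 2 - 2 * Re (f x).
Let near_min e := [set x | J x < inf (range J) + e].

Let J_inf x : inf (range J) <= J x.
Proof.
apply: ge_inf; last by exists x.
exists (- M ^+ 2) => _ [y _ <-].
have h : Re (f y) <= M * rnorm y.
  by rewrite (le_trans _ (f_bound y)) // (le_trans _ (Re_le_cabs _)) ?ler_norm.
have := sqr_ge0 (rnorm y - M); rewrite /J; nra.
Qed.

Let near_min_ex e : 0 < e -> near_min e !=set0.
Proof.
move=> e0; have /(inf_adherent e0) [_ [x _ <-] xe] : has_inf (range J).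
  by split; [exists (J 0); exists 0|exists (inf (range J)) => _ [x _ <-]].
by exists x.
Qed.

(* Parallelogram law: the linear part of J cancels in the second difference. *)
Let near_min_close e x y : near_min e x -> near_min e y ->
  rnorm (x - y) ^+ 2 < 4 * e.
Proof.
rewrite /near_min /= => xe ye.
have fD u v : f (u + v) = f u + f v.
  by have := f_linear 1 u v; rewrite !scale1r.
have fZ (k : C) u : f (k *: u) = k * f u.
  have f0 : f 0 = 0.
    by have /esym/eqP := fD 0 0; rewrite addr0 addrC -subr_eq0 addrK => /eqP.
  by have := f_linear k u 0; rewrite f0 !addr0.
have := J_inf ((2^-1 : R)%:C *: (x + y)).
have xy : rnorm (x - y) ^+ 2 + rnorm (x + y) ^+ 2 =
    2 * rnorm x ^+ 2 + 2 * rnorm y ^+ 2.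
  rewrite !rnormD_sqr rnormN.
  have -> : '[x, - y] = - '[x, y] by exact: linearNr.
  by case: '[x, y] => a b /=; ring.
rewrite /J in xe ye *.
rewrite rnormZ fZ fD cabs_real ger0_norm ?invr_ge0 // exprMn.
move: xe ye; case: (f x) => a b; case: (f y) => c d /=; rewrite mul0r subr0.
lra.
Qed.

(* The derivative of J at a near-minimiser is small: compare J at x with J after
   a step along v against the gradient. *)
Let near_min_deriv e x v : near_min e x ->
  cabs ('[v, x] - f v) ^+ 2 <= e * (1 + rnorm v ^+ 2).
Proof.
rewrite /near_min /= => xe; set c := _ - _.
have := sqr_ge0 (cabs c); set q := cabs c ^+ 2 => q0.
have n0 := sqr_ge0 (rnorm v); set n := rnorm v ^+ 2 in n0 *.
(* This step length makes the quadratic term at most half of the linear gain. *)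
pose s := (1 + n)^-1; have s1 : s * (1 + n) = 1.
  by rewrite mulVf // lt0r_neq0 // ltr_pwDl.
have s0 : 0 < s by rewrite invr_gt0 ltr_pwDl.
have := J_inf ((- s%:C * Num.conj c) *: v + x).
have -> : J ((- s%:C * Num.conj c) *: v + x) = J x + s ^+ 2 * q * n - 2 * s * q.
  rewrite /J rnormD_sqr f_linear rnormZ cabsM cabs_conj.
  rewrite (@rnormN _ C^o) cabs_real !exprMn real_normK ?num_real //.
  rewrite -/q -/n innerZl.
  have -> : q = Re (c * Num.conj c) by rewrite -cabs_sqrC.
  rewrite [_ *: f v]/(_ * f v) /c; case: (f x) => a'' b''.
  by case: '[v, x] => a b; case: (f v) => a' b' /=; ring.
move=> h; have {h} : s * q * (2 - s * n) < e by nra.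
have -> : 2 - s * n = 1 + s by lra.
move=> h; rewrite -(@ler_pM2l _ s) //.
have -> : s * (e * (1 + n)) = e * (s * (1 + n)) by ring.
rewrite s1 mulr1; nra.
Qed.

(** The near-minimisers of [J] form a Cauchy filter; the derivative of [J] at its
    limit vanishes, which is the asserted identity. *)
Theorem riesz_representation : exists y, forall v, f v = '[v, y].
Proof.
pose F : set_system H := filter_from [set e : R | 0 < e] near_min.
have FF : ProperFilter F.
  apply: filter_from_proper => [|e e0]; last exact: near_min_ex.
  apply: filter_from_filter => [|e e' /= e0 e'0]; first by exists 1 => /=.
  exists (Order.min e e'); first by rewrite /= lt_min e0.
  move=> x; rewrite /near_min /= => h.
  by split; apply: lt_le_trans h _; rewrite lerD2l ge_min lexx ?orbT.
have rC (e : C) : 0 < e -> exists2 r : R, 0 < r & e = r%:C.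
  move=> e0; exists (Re e); last by rewrite RRe_real ?gtr0_real.
  by rewrite -ltcR RRe_real ?gtr0_real.
have /cauchy_cvg Fcvg : cauchy F.
  apply: cauchy_exP => _ /rC[r r0 ->].
  have e0 : 0 < (r / 2) ^+ 2 by rewrite exprn_gt0 // divr_gt0.
  have [x xe] := near_min_ex e0.
  exists x; exists ((r / 2) ^+ 2) => //= y ye.
  rewrite -ball_normE /= normE ltcR.
  rewrite -(@ltr_pXn2r _ 2) ?nnegrE ?rnorm_ge0 ?ltW //.
  by apply: lt_le_trans (near_min_close xe ye) _; lra.
exists (lim F) => v; apply/esym/eqP; rewrite -subr_eq0.
apply/eqP/(@rnorm0_eq0 _ C^o)/eqP; rewrite eq_le rnorm_ge0 andbT.
apply/ler_addgt0Pr => e e0; rewrite add0r.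
pose k := 1 + rnorm v; have k0 : 0 < k by rewrite ltr_pwDl ?rnorm_ge0.
pose r := e / k; have r0 : 0 < r by rewrite divr_gt0.
pose d := r ^+ 2 / (1 + rnorm v ^+ 2).
have d0 : 0 < d by rewrite divr_gt0 ?exprn_gt0 // ltr_pwDl ?sqr_ge0.
have Fd : F (near_min d) by exists d.
have Fb : F [set x | rnorm (lim F - x) < r].
  have := Fcvg _ (nbhsx_ballx (lim F) r%:C _); rewrite (ltcR 0) => /(_ r0).
  by apply: filterS => x; rewrite -ball_normE /= normE ltcR.
have [x [xd xr]] := filter_ex (filterI Fd Fb).
have := near_min_deriv v xd; rewrite /d divfK; last first.
  by rewrite lt0r_neq0 // ltr_pwDl ?sqr_ge0.
rewrite ler_pXn2r ?nnegrE ?rnorm_ge0 ?(ltW r0) // => h.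
rewrite (_ : _ - _ = '[v, lim F - x] + ('[v, x] - f v)); last first.
  by rewrite innerBr; ring.
apply: le_trans (@ler_rnormD _ C^o _ _) _.
have -> : e = r * rnorm v + r.
  by rewrite -[LHS](divfK (lt0r_neq0 k0)) -/r /k; ring.
rewrite lerD //; apply: le_trans (cauchy_schwarz _ _) _.
by rewrite mulrC ler_wpM2r ?rnorm_ge0 // ltW.
Qed.

End Riesz.

(** * The universal representation *)

Section UniversalRepresentationTheory.
Context {R : realType}.
Local Notation C := (R[i] : numFieldType).
Local Notation cabs := (rnorm (V := C^o)).

(** By Bernoulli's inequality: otherwise the powers of [r / b] are unbounded. *)
Lemma le_of_pow2_le (r b k : R) : 0 <= r -> 0 <= b ->
  (forall n, r ^+ (2 ^ n) <= k * b ^+ (2 ^ n)) -> r <= b.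
Proof.
move=> r0 b0 h; rewrite leNgt; apply/negP => br.
have rp : 0 < r by apply: le_lt_trans br.
have bp : 0 < b.
  rewrite lt_def b0 andbT; apply/eqP => bE.
  by have := h 0%N; rewrite expn0 !expr1 bE mulr0 leNgt rp.
pose q := r / b - 1.
have q0 : 0 < q by rewrite subr_gt0 ltr_pdivlMr // mul1r.
have bern m : 1 + m%:R * q <= (r / b) ^+ m.
  elim: m => [|m IH]; first by rewrite mul0r addr0 expr0.
  rewrite exprS -natr1; have -> : r / b = 1 + q by rewrite /q addrC subrK.
  rewrite (_ : r / b = 1 + q) in IH; last by rewrite /q addrC subrK.
  have : (1 + q) * (1 + m%:R * q) <= (1 + q) * (1 + q) ^+ m.
    by rewrite ler_pM2l // addr_gt0.
  apply: le_trans; have : 0 <= m%:R * q * q by rewrite !mulr_ge0 // ltW.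
  lra.
pose n := (Num.truncn (k / q)).+1.
have nk : k < n%:R * q by rewrite -ltr_pdivrMr // truncnS_gt.
have := h n; rewrite -ler_pdivrMr ?exprn_gt0 // -expr_div_n leNgt => /negP; apply.
apply: lt_le_trans (bern _); apply: lt_le_trans nk _.
apply: (@le_trans _ _ ((2 ^ n)%:R * q)); last by rewrite lerDr.
by rewrite ler_pM2r // ler_nat ltnW // ltn_expl.
Qed.

Lemma subrACA (V : zmodType) (a b c d : V) : a - b - (c - d) = a - c - (b - d).
Proof. by rewrite !opprB addrACA [RHS]addrACA (addrC (- b)). Qed.

Lemma dense_approx (V : normedModType C) (S : set V) (x : V) (e : R) :
  dense S -> 0 < e -> exists2 s, S s & rnorm (x - s) < e.
Proof.
move=> dS e0; have e0' : 0 < e%:C by rewrite (ltcR 0).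
have := ball_open x e%:C; rewrite -ball_normE => oB.
have xB : ball_ Num.norm x e%:C x by rewrite /ball_ /= subrr normr0.
have [s [/= sB Ss]] := dS _ (ex_intro _ x xB) oB.
by exists s => //; move: sB; rewrite normE ltcR.
Qed.

Variables (X : cstarType R) (H : universal_rep X).
Local Notation "''[' x , y ]" := (inner H x y).
Implicit Types (x y c : X) (l : seq (state X * X)) (h : H).

Lemma rnorm_cmul x y : rnorm (cmul x y) <= rnorm x * rnorm y.
Proof. by rewrite -lecR rmorphM /= -!normE cmul_norm. Qed.

Lemma rnorm_cstar x : rnorm (cmul (cadj x) x) = rnorm x ^+ 2.
Proof. by apply: complexI; rewrite rmorphXn /= -!normE cstar_norm. Qed.

(** These vectors are dense, and on them the representation is computed in [X]. *)
Definition gsum l : H :=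
  \sum_(p <- l) univ_inj H p.1 (gns_vec (univ_gns H p.1) p.2).

Definition lact x l := [seq (p.1, cmul x p.2) | p <- l].

Lemma rnorm_univ_inj (phi : state X) (u : univ_gns H phi) :
  rnorm (univ_inj H phi u) = rnorm u.
Proof.
apply/eqP; rewrite -(@eqrXn2 _ 2) ?rnorm_ge0 //; apply/eqP/complexI.
by rewrite -!inner_rnorm univ_isometry.
Qed.

Lemma gsum_dense h e : 0 < e -> exists l, rnorm (h - gsum l) < e.
Proof.
move=> e0; have e2 : 0 < e / 2 by rewrite divr_gt0.
have [_ [s _ <-] hs] := @dense_approx _ _ h _ (@univ_dense _ _ H) e2.
suff [l sl] : exists l,
    rnorm (\sum_(p <- s) univ_inj H (projT1 p) (projT2 p) - gsum l) < e / 2.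
  exists l; set u := \sum_(p <- s) _ in sl hs.
  have := ler_rnorm_dist h u (gsum l).
  by move/le_lt_trans; apply; rewrite (splitr e) ltrD.
elim: s (e / 2) e2 {hs} => [|[phi u] s IH] d d0.
  by exists [::]; rewrite /gsum !big_nil subrr rnorm0.
have d2 : 0 < d / 2 by rewrite divr_gt0.
have [l sl] := IH _ d2.
have [_ [a _ <-] ua] := dense_approx u (@gns_dense _ _ _ (univ_gns H phi)) d2.
exists ((phi, a) :: l); rewrite /gsum !big_cons /= -/(gsum l).
rewrite opprD addrACA; apply: le_lt_trans (ler_rnormD _ _) _.
by rewrite (splitr d) ltrD // -linearB /= rnorm_univ_inj.
Qed.

Lemma univ_rep_gsum x l : univ_rep H x (gsum l) = gsum (lact x l).
Proof.
rewrite /gsum linear_sum /= /lact big_map; apply: eq_bigr => p _.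
by rewrite univ_act gns_act.
Qed.

Lemma inner_gsum l l' : '[gsum l, gsum l'] = \sum_(p <- l) \sum_(q <- l')
  '[univ_inj H p.1 (gns_vec (univ_gns H p.1) p.2),
    univ_inj H q.1 (gns_vec (univ_gns H q.1) q.2)].
Proof.
rewrite /gsum linear_sumlz; apply: eq_bigr => p _.
by rewrite linear_sumr.
Qed.

(** Terms over different states are orthogonal on both sides; over one state the
    identity is [(x^* b)^* a = b^* (x a)]. *)
Lemma gsum_adjoint x l l' :
  '[gsum (lact x l), gsum l'] = '[gsum l, gsum (lact (cadj x) l')].
Proof.
rewrite !inner_gsum /lact big_map; apply: eq_bigr => -[phi a] _.
rewrite big_map; apply: eq_bigr => -[psi b] _ /=.
have [e|ne] := pselect (phi = psi); last by rewrite !univ_orthogonal.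
by case: _ / e b => b; rewrite !univ_isometry !gns_inner cadjM cadjK cmulA.
Qed.

Lemma gns_vec_le (phi : state X) a : rnorm (gns_vec (univ_gns H phi) a) <= rnorm a.
Proof.
rewrite -(@ler_pXn2r _ 2) ?nnegrE ?rnorm_ge0 //.
have -> : rnorm (gns_vec (univ_gns H phi) a) ^+ 2 =
    Re (sval phi (cmul (cadj a) a)).
  by rewrite -(gns_inner (univ_gns H phi)) inner_rnorm.
apply: le_trans (ler_norm _) _; apply: le_trans (Re_le_cabs _) _.
rewrite -rnorm_cstar.
have /opnorm_le1 : (opnorm (sval phi) <= 1)%E by case: phi => phi [_ /= ->].
exact.
Qed.

Lemma gsum_lact_bound l :
  exists k, forall x, rnorm (gsum (lact x l)) <= k * rnorm x.
Proof.
exists (\sum_(p <- l) rnorm p.2) => x.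
rewrite /gsum /lact big_map mulr_suml.
elim: l => [|p l IH]; first by rewrite !big_nil rnorm0.
rewrite !big_cons; apply: le_trans (ler_rnormD _ _) _.
rewrite lerD // rnorm_univ_inj; apply: le_trans (gns_vec_le _ _) _.
by rewrite mulrC rnorm_cmul.
Qed.

(** Let [c_0 = x^* x] and [c_(n+1) = c_n c_n].  Cauchy-Schwarz bounds the squared
    norm of [c_n h] by that of [h] times that of [c_(n+1) h], so a ratio [r]
    between the squared norms of [x h] and [h] gives growth at least [r^(2^n)]
    for [c_n h].  The crude bound [gsum_lact_bound] together with the
    C*-identity limits this growth to a constant times [|x|^(2 2^n)], and the
    constant is lost in the limit. *)
Lemma rnorm_gsum_lact x l : rnorm (gsum (lact x l)) <= rnorm x * rnorm (gsum l).
Proof.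
pose c n := iter n (fun y => cmul y y) (cmul (cadj x) x).
have cS n : cadj (c n) = c n.
  by elim: n => [|n IH] /=; rewrite cadjM ?cadjK ?IH.
have cn n : rnorm (c n) <= (rnorm x ^+ 2) ^+ (2 ^ n).
  elim: n => [|n IH] /=; first by rewrite rnorm_cstar.
  apply: le_trans (rnorm_cmul _ _) _.
  by rewrite expnS mul2n -addnn exprD ler_pM ?rnorm_ge0.
have lactM y z : lact y (lact z l) = lact (cmul y z) l.
  by rewrite /lact -map_comp; apply: eq_map => p /=; rewrite cmulA.
have sq y : rnorm (gsum (lact y l)) ^+ 2 <=
    rnorm (gsum l) * rnorm (gsum (lact (cmul (cadj y) y) l)).
  have -> : rnorm (gsum (lact y l)) ^+ 2 =
      Re '[gsum l, gsum (lact (cmul (cadj y) y) l)].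
    by rewrite -lactM -gsum_adjoint inner_rnorm.
  apply: le_trans (ler_norm _) _; apply: le_trans (Re_le_cabs _) _.
  exact: cauchy_schwarz.
have [k kP] := gsum_lact_bound l.
set h0 := rnorm (gsum l).
have [h00|h00] := eqVneq h0 0.
  have /(_ x) := sq; rewrite -/h0 h00 mul0r => h.
  rewrite mulr0; have := sqr_ge0 (rnorm (gsum (lact x l))).
  by move=> h'; rewrite -(@ler_pXn2r _ 2) ?nnegrE ?rnorm_ge0 // expr0n.
have hp : 0 < h0 by rewrite lt_def h00 rnorm_ge0.
rewrite -ler_pdivrMr // -(@ler_pXn2r _ 2) ?nnegrE ?divr_ge0 ?rnorm_ge0 //.
set r := _ ^+ 2.
have rv n : r ^+ (2 ^ n) <= rnorm (gsum (lact (c n) l)) / h0.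
  elim: n => [|n IH].
    rewrite expn0 expr1 /r expr_div_n ler_pdivrMr ?exprn_gt0 //.
    by rewrite [h0 ^+ 2]expr2 mulrA divfK // mulrC sq.
  rewrite expnS mul2n -addnn exprD.
  apply: (@le_trans _ _ ((rnorm (gsum (lact (c n) l)) / h0) ^+ 2)).
    by rewrite expr2 ler_pM // exprn_ge0 // sqr_ge0.
  rewrite expr_div_n ler_pdivrMr ?exprn_gt0 //.
  rewrite [h0 ^+ 2]expr2 mulrA divfK // mulrC; have := sq (c n).
  by rewrite cS.
apply: (@le_of_pow2_le _ _ (`|k| / h0)); rewrite ?sqr_ge0 // => n.
apply: le_trans (rv n) _; rewrite mulrAC ler_wpM2r ?invr_ge0 ?rnorm_ge0 //.
apply: le_trans (kP _) _; apply: (@le_trans _ _ (`|k| * rnorm (c n))).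
  by rewrite ler_wpM2r ?rnorm_ge0 ?ler_norm.
by rewrite ler_wpM2l.
Qed.

Lemma rnorm_univ_rep x h : rnorm (univ_rep H x h) <= rnorm x * rnorm h.
Proof.
have [k [k0 kP]] := bop_bound (univ_rep H x).
apply/ler_addgt0Pr => e e0.
have q0 : 0 < k + rnorm x + 1 by rewrite ltr_wpDl ?addr_ge0 ?rnorm_ge0.
have d0 : 0 < e / (k + rnorm x + 1) by rewrite divr_gt0.
have [l hl] := gsum_dense h d0.
have -> : univ_rep H x h = univ_rep H x (h - gsum l) + univ_rep H x (gsum l).
  by rewrite -linearD subrK.
apply: le_trans (ler_rnormD _ _) _.
have h1 := kP (h - gsum l).
have h2 := rnorm_gsum_lact x l; rewrite -univ_rep_gsum in h2.
have h3 : rnorm (gsum l) <= rnorm (h - gsum l) + rnorm h.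
  by rewrite rnormBC -{1}[gsum l](subrK h) ler_rnormD.
move: hl; rewrite ltr_pdivlMr // => hl.
have x0 := rnorm_ge0 x; have := rnorm_ge0 (h - gsum l).
nra.
Qed.

Lemma zero_of_gsum (T : H -> H) (k : R) : {morph T : h h' / h - h'} ->
  (forall h, rnorm (T h) <= k * rnorm h) -> (forall l, T (gsum l) = 0) ->
  forall h, T h = 0.
Proof.
move=> TB Tk T0 h; apply/rnorm0_eq0/eqP; rewrite eq_le rnorm_ge0 andbT.
apply/ler_addgt0Pr => e e0; rewrite add0r.
have q0 : 0 < `|k| + 1 by rewrite ltr_wpDl.
have d0 : 0 < e / (`|k| + 1) by rewrite divr_gt0.
have [l hl] := gsum_dense h d0.
have := Tk (h - gsum l); rewrite TB T0 subr0 => /le_trans; apply.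
move: hl; rewrite ltr_pdivlMr // => hl.
have := rnorm_ge0 (h - gsum l); have := ler_norm k; nra.
Qed.

(** The action is computed on the dense vectors [gsum l]; linearity in the algebra
    element and multiplicativity extend from there by continuity. *)
Lemma univ_rep_linear h : linear (fun x => univ_rep H x h).
Proof.
move=> k x y; apply/eqP; rewrite -subr_eq0; apply/eqP.
apply: (@zero_of_gsum (fun h => univ_rep H (k *: x + y) h -
  (k *: univ_rep H x h + univ_rep H y h))
  (rnorm (k *: x + y) + (cabs k * rnorm x + rnorm y))).
- move=> h1 h2; rewrite !(linearB (univ_rep H _)) /= scalerBr.
  by rewrite (addrACA (k *: _)) -opprD subrACA.
- move=> h1; apply: le_trans (ler_rnormD _ _) _; rewrite rnormN mulrDl.
  rewrite lerD ?rnorm_univ_rep //. apply: le_trans (ler_rnormD _ _) _.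
  rewrite mulrDl lerD ?rnorm_univ_rep // rnormZ -mulrA.
  by rewrite ler_wpM2l ?rnorm_ge0 ?rnorm_univ_rep.
- move=> l; rewrite !univ_rep_gsum /gsum /lact !big_map scaler_sumr.
  apply/eqP; rewrite subr_eq0 -big_split /=; apply/eqP/eq_bigr => p _.
  by rewrite cmul_linearl !linearP.
Qed.

Lemma univ_repM x y h : univ_rep H (cmul x y) h = univ_rep H x (univ_rep H y h).
Proof.
apply/eqP; rewrite -subr_eq0; apply/eqP.
apply: (@zero_of_gsum (fun h => univ_rep H (cmul x y) h -
  univ_rep H x (univ_rep H y h)) (rnorm x * rnorm y + rnorm x * rnorm y)).
- by move=> h1 h2; rewrite !(linearB (univ_rep H _)) /= subrACA.
- move=> h1; apply: le_trans (ler_rnormD _ _) _; rewrite rnormN mulrDl.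
  rewrite lerD // ?(le_trans (rnorm_univ_rep _ _)) //.
    by rewrite ler_wpM2r ?rnorm_ge0 ?rnorm_cmul.
  by rewrite -mulrA ler_wpM2l ?rnorm_ge0 ?rnorm_univ_rep.
- move=> l; rewrite !univ_rep_gsum /lact -map_comp.
  apply/eqP; rewrite subr_eq0; apply/eqP; congr gsum.
  by apply: eq_map => p /=; rewrite cmulA.
Qed.

Lemma vec_fun_exists (xi rho : H) :
  exists phi : top_dual X, forall x, phi x = '[univ_rep H x rho, xi].
Proof.
apply: (@bop_exists _ _ (C^o) (fun x => '[univ_rep H x rho, xi])
    (rnorm rho * rnorm xi)).
  by move=> k x y; rewrite univ_rep_linear innerDl innerZl.
move=> x; apply: le_trans (cauchy_schwarz _ _) _.
rewrite mulrAC (mulrC (rnorm rho)).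
by rewrite ler_wpM2r ?rnorm_ge0 // rnorm_univ_rep.
Qed.

Definition vec_fun xi rho : top_dual X := sval (cid (vec_fun_exists xi rho)).

Lemma vec_funE xi rho x : vec_fun xi rho x = '[univ_rep H x rho, xi].
Proof. by rewrite /vec_fun; case: cid. Qed.

End UniversalRepresentationTheory.

(** * Weakly finite points *)

Section WeaklyFinite.
Context {R : realType} {U : nonstandard_extension}.
Local Notation C := (R[i] : numFieldType).
Local Notation cabs := (rnorm (V := C^o)).

Lemma sfinite_along T (f : T -> R) (z : star U T) :
  sfinite (sext f z) <-> exists n, along z [set t | `|f t| < n%:R].
Proof.
rewrite /sfinite /sless sext_comp.
by split=> -[n h]; exists n; move: h; rewrite -(sext_cst _ z) srel2_sext.
Qed.

Lemma stR T (f : T -> R) (z : star U T) (M : R) :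
  along z [set t | `|f t| <= M] ->
  forall e, 0 < e -> along z [set t | `|f t - st (sext f z)| < e].
Proof.
move=> fM; have [l L] := along_bounded_limit fM.
apply/snearR; rewrite sext_cst /st.
apply: (@xgetPex _ 0 [set x : R | snear (sext f z) (std x)]).
by exists l; rewrite /= -(sext_cst _ z); apply/snearR.
Qed.

Variable X : normedModType C.
Implicit Types (phi : top_dual X) (a b : star U X).

Lemma weak_fin_along a : weak_fin a <->
  exists M, forall phi, (opnorm phi <= 1)%E -> along a [set t | cabs (phi t) <= M].
Proof.
pose nu (phi : top_dual X) := sext (rnorm (V := C^o)) (sext (phi : X -> R[i]) a).
have nuE phi : nu phi = sext (fun t => cabs (phi t)) a by rewrite /nu sext_comp.
split=> [fin|[M h]]; last first.
  apply: (@le_lt_trans _ _ M%:E); last exact: ltry.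
  apply: ge_ereal_sup => _ [phi p1 <-]; rewrite -/(nu phi).
  have {}h : along a [set t | `|cabs (phi t)| <= M].
    by apply: along_sub (h _ p1) => t /=; rewrite ger0_norm ?rnorm_ge0.
  rewrite /est asboolT; last first.
    rewrite nuE; apply/sfinite_along; exists (Num.truncn M).+1.
    by apply: along_sub h => t /= /le_lt_trans; apply; rewrite truncnS_gt.
  rewrite lee_fin nuE; apply/ler_addgt0Pr => e e0.
  have [t /= [h1 h2]] := filter_ex (alongI h (stR h e0)).
  move: h2; rewrite ltr_distlC => /andP[h2 h3].
  have := le_trans (ler_norm _) h1; lra.
move: fin; rewrite /weak_fin /=; set S := ereal_sup _ => fin.
have nuS phi : (opnorm phi <= 1)%E -> (est (nu phi) <= S)%E.
  by move=> p1; apply: ereal_sup_ubound; exists phi.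
exists (fine S + 1) => phi p1; have := nuS _ p1.
rewrite /est; case: asboolP => [sf|_]; last first.
  by rewrite leNgt => /negP; case.
move=> le_S; have SE : S = (fine S)%:E.
  by rewrite fineK // fin_real // fin andbT; apply: lt_le_trans le_S; exact: ltNyr.
rewrite SE lee_fin in le_S; rewrite nuE in sf le_S.
have [n h] := (sfinite_along _ _).1 sf.
have := @stR _ _ _ n%:R (along_sub (fun t => @ltW _ _ _ _) h) 1 ltr01.
apply: along_sub => t /=; rewrite ltr_distlC => /andP[h1 h2].
lra.
Qed.

Lemma dual_scale phi (r : R) : exists phi' : top_dual X,
  forall x, phi' x = r%:C * phi x.
Proof.
have [k [k0 kP]] := bop_bound phi.
apply: (@bop_exists _ _ (C^o) (fun x => r%:C * phi x) (`|r| * k)).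
  by move=> z x y; rewrite linearP mulrDr; congr (_ + _); exact: mulrCA.
by move=> x; rewrite cabsM cabs_real -mulrA ler_wpM2l.
Qed.

Lemma weak_fin_bound a : weak_fin a -> exists M, 0 <= M /\
  forall phi k, 0 <= k -> (forall x, cabs (phi x) <= k * rnorm x) ->
    along a [set t | cabs (phi t) <= M * k].
Proof.
move/weak_fin_along => [M h]; exists `|M|; split=> // phi k k0 phik.
have [kE|kn0] := eqVneq k 0.
  apply: along_sub (alongT a) => t _ /=.
  by apply: le_trans (phik t) _; rewrite kE mul0r mulr0.
have kp : 0 < k by rewrite lt_def kn0.
have [phi' phiE] := dual_scale phi k^-1.
have /h : (opnorm phi' <= 1)%E.
  apply/opnorm_le1 => x; rewrite phiE cabsM cabs_real ger0_norm ?invr_ge0 //.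
  by rewrite mulrC ler_pdivrMr // mulrC.
apply: along_sub => t /=; rewrite phiE cabsM cabs_real ger0_norm ?invr_ge0 //.
rewrite mulrC ler_pdivrMr // => /le_trans; apply.
by rewrite ler_wpM2r // ler_norm.
Qed.

Lemma weak_fin_dual a phi : weak_fin a ->
  exists M, along a [set t | cabs (phi t) <= M].
Proof.
move=> /weak_fin_bound[M [_ h]]; have [k [k0 kP]] := bop_bound phi.
by exists (M * k); apply: h.
Qed.

(** [l] is the element of the bidual represented by [a], described without
    standard parts. *)
Definition weakly_tends a (l : top_dual X -> R[i]) :=
  forall phi e, 0 < e -> along a [set t | cabs (phi t - l phi) < e].

Lemma weakly_tends_clim a : weak_fin a ->
  weakly_tends a (fun phi => clim a (phi : X -> R[i])).
Proof. by move=> af phi; have [M] := weak_fin_dual phi af; apply: climP. Qed.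

Lemma weakly_tends_near a b l :
  weakly_tends a l -> weakly_tends b l -> weak_near a b.
Proof.
move=> al bl phi; have [w [aE bE]] := spair_ex a b; rewrite aE bE in al bl *.
rewrite !sext_comp; apply/snearC => e e0.
have e2 : 0 < e / 2 by rewrite divr_gt0.
have /along_sext h1 := al phi _ e2; have /along_sext h2 := bl phi _ e2.
apply: along_sub (alongI h1 h2) => -[s t] /= [h h'].
apply: le_lt_trans (@ler_rnorm_dist _ C^o _ (l phi) _) _.
by rewrite (splitr e) ltrD // (@rnormBC _ C^o).
Qed.

Lemma weak_near_tends a b l : weak_near a b -> weakly_tends a l -> weakly_tends b l.
Proof.
move=> ab al phi e e0; have [w [aE bE]] := spair_ex a b.
have e2 : 0 < e / 2 by rewrite divr_gt0.
have := ab phi; rewrite aE bE !sext_comp => /snearC/(_ _ e2) h.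
have := al phi _ e2; rewrite aE => /along_sext h2.
apply/along_sext; apply: along_sub (alongI h h2) => -[s t] /= [h1 h3].
apply: le_lt_trans (@ler_rnorm_dist _ C^o _ (phi s) _) _.
by rewrite (splitr e) ltrD // (@rnormBC _ C^o).
Qed.

Lemma weakly_tends_fin a l M : weakly_tends a l ->
  (forall phi, (opnorm phi <= 1)%E -> cabs (l phi) <= M) -> weak_fin a.
Proof.
move=> al lM; apply/weak_fin_along; exists (1 + M) => phi p1.
apply: along_sub (al phi _ ltr01) => t /= h.
have := @ler_rnormD _ C^o (phi t - l phi) (l phi); rewrite subrK.
by move/le_trans; apply; rewrite lerD ?lM // ltW.
Qed.

(** A point belongs to its own coset, so equality of cosets puts [b] in the coset
    of [a]. *)
Lemma weakly_tends_hat a b l : hat b = hat a -> weakly_tends a l -> weakly_tends b l.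
Proof.
move=> ba al; apply: weak_near_tends al => phi.
have bb : hat b b.
  exists (std 0); last first.
    rewrite -[b in LHS]sext_id -(sext_cst _ b) sext2_sext -[RHS]sext_id.
    by congr sext; apply/funext => t /=; rewrite addr0.
  split; last first.
    move=> psi; rewrite -(sext_cst _ a) sext_comp; apply/snearC => e e0.
    by apply: along_sub (alongT a) => t _ /=; rewrite subrr rnorm0.
  apply/weak_fin_along; exists 0 => psi _; apply/along_std => /=.
  by rewrite linear0 rnorm0.
move: bb; rewrite ba => -[z [_ /(_ phi) z0] bE].
have [w [aE zE]] := spair_ex a z.
move: z0; rewrite -bE aE zE -(sext_cst _ w) sext2_sext !sext_comp.
move/snearC => h; apply/snearC => e e0; apply: along_sub (h e e0) => t /=.
rewrite linear0 subr0 linearD opprD addrA subrr sub0r.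
by rewrite (@rnormN _ C^o).
Qed.

End WeaklyFinite.

(** * The operator attached to a point of the weak hull *)

Section HullRepresentation.
Context {R : realType} {U : nonstandard_extension}.
Local Notation C := (R[i] : numFieldType).
Local Notation cabs := (rnorm (V := C^o)).
Variables (X : cstarType R) (H : universal_rep X).
Local Notation "''[' x , y ]" := (inner H x y).

Lemma rnorm_vec_fun (xi rho : H) (x : X) :
  cabs (vec_fun xi rho x) <= rnorm rho * rnorm xi * rnorm x.
Proof.
rewrite vec_funE; apply: le_trans (@cauchy_schwarz _ H _ _) _.
by rewrite mulrAC (mulrC (rnorm rho)) ler_wpM2r ?rnorm_ge0 // rnorm_univ_rep.
Qed.

(** The functional is linear in its argument while the form is antilinear in the
    second one, whence the conjugation. *)
Lemma st_sinner (a : star U X) (xi rho : H) : weak_fin a ->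
  st (K := C) (sinner (std xi) (sact a (std rho))) =
  Num.conj (clim a (vec_fun xi rho : X -> R[i])).
Proof.
move=> af; have [M hM] := weak_fin_dual (vec_fun xi rho) af.
rewrite -(clim_conj hM) /clim /sinner /sact.
rewrite -(sext_cst rho a) -(sext_cst xi a) -{2}[a]sext_id !sext2_sext.
congr (st (sext _ _)); apply/funext => t.
by rewrite vec_funE inner_conj.
Qed.

(** For fixed [rho] the conjugate of [xi |-> clim a (vec_fun xi rho)] is a bounded
    linear functional of [xi]; Riesz represents it by the value at [rho]. *)
Lemma hull_operator_exists (a : star U X) : weak_fin a ->
  exists T : bop H H, forall xi rho : H,
    '[T rho, xi] = clim a (vec_fun xi rho : X -> R[i]).
Proof.
move=> af; have [M [M0 hM]] := weak_fin_bound af.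
have vb (xi rho : H) :
    along a [set t | cabs (vec_fun xi rho t) <= M * (rnorm rho * rnorm xi)].
  by apply: hM => [|x]; rewrite ?mulr_ge0 ?rnorm_ge0 ?rnorm_vec_fun.
have /choice [T TP] : forall rho : H, exists y : H, forall xi,
    '[y, xi] = clim a (vec_fun xi rho : X -> R[i]).
  move=> rho.
  have [||y yP] := @riesz_representation _ H
      (fun xi => Num.conj (clim a (vec_fun xi rho : X -> R[i]))) (M * rnorm rho).
  - move=> k xi xi'.
    have -> : clim a (vec_fun (k *: xi + xi') rho : X -> R[i]) =
        clim a (fun t => Num.conj k * vec_fun xi rho t + vec_fun xi' rho t).
      by congr (clim a _); apply/funext => t; rewrite !vec_funE innerDr innerZr.
    rewrite (clim_linear _ (vb _ _) (vb _ _)) rmorphD rmorphM /=.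
    by rewrite conjCK.
  - by move=> xi; rewrite cabs_conj -mulrA; apply/clim_le.
  by exists y => xi; rewrite -inner_conj -yP conjCK.
suff [S ST] : exists S : bop H H, S =1 T by exists S => xi rho; rewrite ST.
apply: (@bop_exists _ _ _ T M).
  move=> k r s; apply: inner_eq => xi.
  rewrite -!(inner_conj _ xi); congr (Num.conj _).
  rewrite innerDl innerZl !TP -(clim_linear _ (vb _ _) (vb _ _)).
  congr (clim a _); apply/funext => t.
  by rewrite !vec_funE linearP innerDl innerZl.
move=> rho.
have [->|T0] := eqVneq (rnorm (T rho)) 0; first by rewrite mulr_ge0 ?rnorm_ge0.
rewrite -(@ler_pM2r _ (rnorm (T rho))) ?lt_def ?T0 ?rnorm_ge0 //.
have -> : rnorm (T rho) * rnorm (T rho) = cabs '[T rho, T rho].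
  by rewrite inner_rnorm cabs_real ger0_norm ?sqr_ge0 // expr2.
by rewrite TP -mulrA; apply/clim_le.
Qed.

(** The operator is determined by its matrix coefficients at one representative of
    the coset. *)
Lemma hull_pi_unique (a : star U X) (T : bop H H) : weak_fin a ->
  (forall xi rho : H, '[T rho, xi] = clim a (vec_fun xi rho : X -> R[i])) ->
  hull_pi H (hat a) = T.
Proof.
move=> af TP; rewrite /hull_pi.
set P := [set _ | _].
have PT : P T.
  move=> a' a'f a'a xi rho; rewrite st_sinner // -inner_conj TP; congr (Num.conj _).
  apply/esym/clim_eq.
  exact: weakly_tends_hat a'a (weakly_tends_clim af) (vec_fun xi rho).
have PS := @xgetPex _ (bop0 H H) P (ex_intro _ T PT).
apply: bop_eq => rho; apply: inner_eq => xi.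
by rewrite (PS _ af erefl) (PT _ af erefl).
Qed.

Lemma hull_piP (a : star U X) : weak_fin a -> forall xi rho : H,
  '[hull_pi H (hat a) rho, xi] = clim a (vec_fun xi rho : X -> R[i]).
Proof.
by move=> af; have [T TP] := hull_operator_exists af; rewrite (hull_pi_unique af TP).
Qed.

End HullRepresentation.

(** * Iterated limits and saturation *)

Section IteratedLimits.
Context {R : realType} {U : nonstandard_extension}.
Local Notation C := (R[i] : numFieldType).
Local Notation cabs := (rnorm (V := C^o)).
Variables (X : normedModType C) (m : X -> X -> X).
Hypotheses (m_linl : forall y, linear (m^~ y)) (m_linr : forall x, linear (m x)).
Hypothesis m_norm : forall x y, rnorm (m x y) <= rnorm x * rnorm y.
Implicit Types (phi : top_dual X) (a b : star U X).

(** The functionals [theta] are those through which the Arens products are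
    defined; their norm is controlled uniformly in [phi], which is what makes the
    point found in [iterated_limit] weakly finite. *)
Lemma arens_exists b : weak_fin b -> exists M, 0 <= M /\
  forall phi, exists theta : top_dual X,
    (forall x e, 0 < e -> along b [set t | cabs (phi (m x t) - theta x) < e]) /\
    (forall k, 0 <= k -> (forall x, cabs (phi x) <= k * rnorm x) ->
       forall x, cabs (theta x) <= M * k * rnorm x).
Proof.
move=> bf; have [M [M0 hM]] := weak_fin_bound bf; exists M; split=> // phi.
have bd k x : 0 <= k -> (forall x, cabs (phi x) <= k * rnorm x) ->
    along b [set t | cabs (phi (m x t)) <= M * k * rnorm x].
  move=> k0 kP.
  have le t : cabs (phi (m x t)) <= k * rnorm x * rnorm t.
    by apply: le_trans (kP _) _; rewrite -mulrA ler_wpM2l.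
  have [|psi psiE] := @bop_exists _ _ (C^o) (fun t => phi (m x t)) _ _ le.
    by move=> z s t; rewrite m_linr linearP.
  have psik t : cabs (psi t) <= k * rnorm x * rnorm t by rewrite psiE.
  have kx : 0 <= k * rnorm x by rewrite mulr_ge0 ?rnorm_ge0.
  by apply: along_sub (hM _ _ kx psik) => t /=; rewrite psiE mulrA.
have [k [k0 kP]] := bop_bound phi.
have [|x|theta thetaE] := @bop_exists _ _ (C^o)
    (fun x => clim b (fun t => phi (m x t))) (M * k).
- move=> z x y; apply: etrans _ (clim_linear z (bd k x k0 kP) (bd k y k0 kP)).
  by congr (clim b _); apply/funext => t; rewrite m_linl linearP.
- exact: clim_le (bd k x k0 kP).
exists theta; split=> [x e e0|k' k'0 k'P x]; rewrite thetaE.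
  exact: climP (bd k x k0 kP) _ e0.
exact: clim_le (bd k' x k'0 k'P).
Qed.

(** Finitely many sets that hold along [a] have a common standard point. *)
Lemma finite_approx a (l : top_dual X -> R[i]) : weakly_tends a l ->
  exists x : seq (top_dual X) -> X,
    forall i phi, phi \in i -> cabs (phi (x i) - l phi) < 1.
Proof.
move=> al.
suff /choice[x xP] : forall i : seq (top_dual X), exists x : X,
  forall phi, phi \in i -> cabs (phi x - l phi) < 1 by exists x.
move=> i.
suff : along a [set t | forall phi, phi \in i -> cabs (phi t - l phi) < 1].
  by move/filter_ex.
elim: i => [|phi i IH]; first by apply: along_sub (alongT a).
apply: along_sub (alongI IH (al phi _ ltr01)) => t /= [h1 h2] psi.
by rewrite inE => /predU1P[->|/h1].
Qed.

(** The internal set attached to [phi] consists of the indices that satisfy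
    [P phi] at [b].  Standard indices witness the finite intersection property. *)
Lemma saturated_index (K J : Type) (b : star U X)
    (P : top_dual X -> X -> set J) :
  card_lt (top_dual X) K -> saturated U K ->
  (forall s : seq (top_dual X), exists i : J,
     forall phi, phi \in s -> along b [set t | P phi t i]) ->
  exists w : star U (J * X), b = sext snd w /\
    forall phi, along w [set w | P phi w.2 w.1].
Proof.
move=> [/card_leP[g] _] sat fin_sat.
have [f finj] : exists f : top_dual X -> K, injective f.
  exists (fun phi => val (g (SigSub (mem_set (Logic.I : [set: top_dual X] phi))))).
  move=> x y /val_inj/(@inj _ _ _ g); rewrite !in_setT => /(_ isT isT).
  by move/(congr1 val).
pose S k := sext (fun t => [set i | forall phi, f phi = k -> P phi t i]) b.
have [F Ffin|k kS] := sat J S.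
  have /finite_seqP [s sE] : finite_set (f @^-1` F).
    by apply: finite_preimage Ffin => x y _ _; exact: finj.
  have [i iP] := fin_sat s; exists (std i) => k Fk.
  rewrite /smem -(sext_cst i b); apply/srel2_sext => /=.
  have [[phi phik]|nk] := pselect (exists phi, f phi = k); last first.
    by apply: along_sub (alongT b) => t _ phi phik; case: nk; exists phi.
  apply: along_sub (iP phi _) => [t /= h psi|].
    by rewrite -phik => /finj ->.
  have : (f @^-1` F) phi by rewrite /= phik.
  by rewrite sE.
have [w [kE bE]] := spair_ex k b; exists w; split=> // phi.
have := kS (f phi); rewrite /smem /S kE bE sext_comp => /srel2_sext.
by apply: along_sub => t /=; apply.
Qed.

(** The limit over the second variable is taken first and produces [theta]; the
    point [k] realises the remaining limit simultaneously for all functionals. *)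
Theorem iterated_limit (K : Type) a b :
  card_lt (top_dual X) K -> saturated U K -> weak_fin a -> weak_fin b ->
  exists (x : seq (top_dual X) -> X) (k : star U (seq (top_dual X)))
      (theta : top_dual X -> top_dual X),
    [/\ forall phi e, 0 < e -> exists i : seq (top_dual X),
          forall j : seq (top_dual X), {subset i <= j} ->
          cabs (phi (x j) - clim a (phi : X -> R[i])) < e,
        weakly_tends (sext x k) (fun phi => clim a (phi : X -> R[i])),
        forall phi y e, 0 < e ->
          along b [set t | cabs (phi (m y t) - theta phi y) < e],
        weakly_tends (sext2 m (sext x k) b)
          (fun phi => clim a (theta phi : X -> R[i]))
      & weak_fin (sext x k) /\ weak_fin (sext2 m (sext x k) b)].
Proof.
move=> ltK sat af bf.
pose A phi := clim a (phi : X -> R[i]).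
have aA : weakly_tends a A := weakly_tends_clim af.
have [Ma [Ma0 hMa]] := weak_fin_bound af.
have [Mb [Mb0 /choice [theta thetaP]]] := arens_exists bf.
have [x xP] := finite_approx aA.
(* Replacing phi by a large multiple turns tolerance 1 into any tolerance; A and
   theta respect these multiples. *)
have A_scale phi phi' (r : R) : (forall x, phi' x = r%:C * phi x) ->
    A phi' = r%:C * A phi.
  move=> h; have [M hM] := weak_fin_dual phi af.
  have h0 : along a [set t : X | cabs 0 <= 0].
    by apply: along_sub (alongT a) => t _ /=; rewrite rnorm0.
  have := clim_linear r%:C hM h0.
  have -> : clim a (fun=> 0) = 0 :> R[i].
    apply: clim_eq => e e0; apply: along_sub (alongT a) => t _ /=.
    by rewrite subrr rnorm0.
  rewrite addr0 => <-; congr (clim a _); apply/funext => t.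
  by rewrite h addr0.
have theta_scale phi phi' (r : R) : (forall x, phi' x = r%:C * phi x) ->
    forall x, theta phi' x = r%:C * theta phi x.
  move=> h y; have [h1 _] := thetaP phi; have [h1' _] := thetaP phi'.
  apply: (along_near_uniq (h1' y)) => e e0.
  have r0 : 0 < `|r| + 1 by rewrite ltr_wpDl.
  have e1 : 0 < e / (`|r| + 1) by rewrite divr_gt0.
  apply: along_sub (h1 y _ e1) => t /=; rewrite h -mulrBr cabsM cabs_real.
  rewrite ltr_pdivlMr // => lt; apply: le_lt_trans lt.
  by rewrite mulrC ler_wpM2l ?rnorm_ge0 // lerDl.
have unscale phi e : 0 < e -> exists phi' : top_dual X,
    (forall x, phi' x = e^-1%:C * phi x) /\
    forall z w : R[i], cabs (e^-1%:C * z - e^-1%:C * w) < 1 -> cabs (z - w) < e.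
  move=> e0; have [phi' h] := dual_scale phi e^-1; exists phi'; split=> // z w.
  rewrite -mulrBr cabsM cabs_real ger0_norm ?invr_ge0 ?(ltW e0) // mulrC.
  by rewrite ltr_pdivrMr // mul1r.
pose P phi t i := cabs (phi (x i) - A phi) < 1 /\
  cabs (phi (m (x i) t) - A (theta phi)) < 1.
have [|w [bE wP]] := @saturated_index K _ b P ltK sat.
  (* Closing the list under theta makes the net good at theta phi as well. *)
  move=> s; exists (s ++ map theta s) => phi phis.
  have h1 := xP (s ++ map theta s) phi; rewrite mem_cat phis in h1.
  have h2 := xP (s ++ map theta s) (theta phi).
  rewrite mem_cat map_f ?orbT // in h2.
  set y := x _ in h1 h2 *.
  pose e := 1 - cabs (theta phi y - A (theta phi)).
  have e0 : 0 < e by rewrite subr_gt0 h2.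
  apply: along_sub ((thetaP phi).1 y e e0) => t /= h; split; first exact: h1.
  apply: le_lt_trans (@ler_rnorm_dist _ C^o _ (theta phi y) _) _.
  by rewrite -ltrBrDr.
have t0 : weakly_tends (sext (x \o fst) w) A.
  move=> phi e e0; have [phi' [sc h]] := unscale phi e e0.
  apply/along_sext; apply: along_sub (wP phi') => -[i t] [/= + _].
  by rewrite sc (A_scale _ _ _ sc) => /h.
have t1 : weakly_tends (sext (fun w => m (x w.1) w.2) w) (fun phi => A (theta phi)).
  move=> phi e e0; have [phi' [sc h]] := unscale phi e e0.
  apply/along_sext; apply: along_sub (wP phi') => -[i t] [/= _].
  by rewrite sc (A_scale _ _ _ (theta_scale _ _ _ sc)) => /h.
exists x, (sext fst w), theta; split.
- move=> phi e e0; have [phi' [sc h]] := unscale phi e e0.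
  exists [:: phi'] => j sj; have := xP j phi' (sj _ _).
  rewrite mem_head => /(_ isT).
  by rewrite sc (A_scale _ _ _ sc) => /h.
- by rewrite sext_comp; exact: t0.
- by move=> phi; exact: (thetaP phi).1.
- by rewrite bE sext_comp sext2_sext; exact: t1.
have A_le phi k : 0 <= k -> (forall x, cabs (phi x) <= k * rnorm x) ->
    cabs (A phi) <= Ma * k.
  by move=> k0 kP; apply: clim_le; apply: hMa.
have le1 phi : (opnorm phi <= 1)%E -> forall x, cabs (phi x) <= 1 * rnorm x.
  by move=> /opnorm_le1 h y; rewrite mul1r.
rewrite bE sext_comp sext2_sext; split.
  by apply: (weakly_tends_fin t0) => phi /le1; apply: A_le.
apply: (weakly_tends_fin t1) => phi /le1 phi1.
apply: A_le (Mb * 1) _ _; first by rewrite mulr1.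
exact: (thetaP phi).2.
Qed.

End IteratedLimits.

(** * Convergence in the weak operator topology *)

Section WeakOperatorNets.
Context {R : realType} {U : nonstandard_extension}.
Local Notation C := (R[i] : numFieldType).
Local Notation cabs := (rnorm (V := C^o)).

Lemma net_filter_filter (I : Type) (le : I -> I -> Prop) :
  directed le -> Filter (net_filter le).
Proof.
move=> [[i0 _] _ tr up]; split.
- by exists i0.
- move=> A B [i iA] [j jB]; have [k [ik jk]] := up i j; exists k => l kl.
  by split; [apply: iA; apply: tr kl|apply: jB; apply: tr kl].
- by move=> A B AB [i iA]; exists i => j /iA /AB.
Qed.

Lemma wot_net_cvg (H : hilbertType R) (I : Type) (le : I -> I -> Prop)
    (S : I -> bop H H) (T : bop H H) : directed le ->
  (forall xi rho e, 0 < e -> exists i, forall j, le i j ->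
     cabs (inner H (S j xi) rho - inner H (T xi) rho) < e) ->
  (fun i => S i : wot H) @ net_filter le --> (T : wot H).
Proof.
move=> dir h; have FF := net_filter_filter dir.
apply/cvg_sup; case=> xi rho A.
rewrite nbhsE => -[B [[V Vo <-] VT] VA].
have : nbhs (inner H (T xi) rho : C^o) V by apply: open_nbhs_nbhs.
move=> /nbhs_ballP [e e0 eV].
have er : e = (Re e)%:C by rewrite RRe_real ?gtr0_real.
have e0' : 0 < Re e by rewrite -ltcR -er.
have [i iP] := h xi rho _ e0'; exists i => j ij.
apply: VA; apply: eV; rewrite -ball_normE /= normE er ltcR.
by rewrite (@rnormBC _ C^o); apply: iP.
Qed.

Lemma bop_adjoint (H : hilbertType R) (T : bop H H) (xi : H) :
  exists eta, forall v, inner H (T v) xi = inner H v eta.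
Proof.
have [k [k0 kP]] := bop_bound T.
apply: (@riesz_representation _ H (fun v => inner H (T v) xi) (k * rnorm xi)).
  by move=> z u v; rewrite linearP innerDl innerZl.
move=> v; apply: le_trans (cauchy_schwarz _ _) _.
by rewrite mulrAC ler_wpM2r ?rnorm_ge0.
Qed.

End WeakOperatorNets.

(** * Products of operators of the weak hull *)

Section Product.
Context {R : realType} {U : nonstandard_extension}.
Local Notation C := (R[i] : numFieldType).
Local Notation cabs := (rnorm (V := C^o)).

Lemma sext2C A B D (f : A -> B -> D) (x : star U A) (y : star U B) :
  sext2 f x y = sext2 (fun b a => f a b) y x.
Proof. by have [w [-> ->]] := spair_ex x y; rewrite !sext2_sext. Qed.

(** Taking [m x y = x y] and [m x y = y x] covers both one-sided products.  The
    last hypothesis is where the Hilbert space enters: adjoints keep [theta]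
    within the vector functionals, where [pi (hat a)] is known. *)
Theorem hull_pi_product (X : cstarType R) (H : universal_rep X) (K : Type)
    (m : X -> X -> X) (a b : star U X) (T : bop H H) :
  (forall y, linear (m^~ y)) -> (forall y, linear (m y)) ->
  (forall x y, rnorm (m x y) <= rnorm x * rnorm y) ->
  card_lt (top_dual X) K -> saturated U K -> weak_fin a -> weak_fin b ->
  (forall xi rho : H, exists xi' rho' : H,
     inner H (hull_pi H (hat a) rho') xi' = inner H (T rho) xi /\
     forall y e, 0 < e -> along b
       [set t | cabs (vec_fun xi rho (m y t) - vec_fun xi' rho' y) < e]) ->
  exists a0, [/\ weak_fin a0, weak_near a0 a, weak_fin (sext2 m a0 b),
    T = hull_pi H (hat (sext2 m a0 b)) & term_of_wot_net (hull_pi H (hat a)) a0].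
Proof.
move=> ml mr mn ltK sat af bf hT.
have [x [k [theta [net lim0 thetaP lim1 [fin0 fin1]]]]] :=
  iterated_limit ml mr mn ltK sat af bf.
exists (sext x k); split=> //.
- exact: weakly_tends_near lim0 (weakly_tends_clim af).
- apply/esym/hull_pi_unique => // xi rho.
  have [xi' [rho' [<- lim]]] := hT xi rho; rewrite hull_piP //.
  have -> : clim a (vec_fun xi' rho' : X -> R[i]) =
      clim a (theta (vec_fun xi rho) : X -> R[i]).
    congr (clim a _); apply/funext => y.
    exact: along_near_uniq (lim y) (thetaP _ y).
  exact/esym/clim_eq/lim1.
exists (seq (top_dual X)), (fun i j => {subset i <= j}), x.
have dir : directed (fun i j : seq (top_dual X) => {subset i <= j}).
  split=> [|i|i j l ij jl phi /ij/jl|i j] //; first by exists [::].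
  by exists (i ++ j); split=> phi; rewrite mem_cat => ->; rewrite ?orbT.
split=> //; last by exists k.
apply: wot_net_cvg => // rho xi e e0.
have [i iP] := net (vec_fun xi rho) e e0; exists i => j /iP.
by rewrite vec_funE hull_piP.
Qed.

End Product.

Theorem theorem17 (R : realType) (X : cstarType R) (H : universal_rep X)
    (U : nonstandard_extension) (K : Type)
    (K_uncountable : ~ countable [set: K])
    (dual_lt_K : card_lt (top_dual X) K) (H_lt_K : card_lt H K)
    (K_saturated : saturated U K)
    (a b : star U X) (a_fin : weak_fin a) (b_fin : weak_fin b) :
  (exists a0 : star U X,
     [/\ weak_fin a0, weak_near a0 a, weak_fin (smul a0 b),
         bop_comp (hull_pi H (hat a)) (hull_pi H (hat b))
           = hull_pi H (hat (smul a0 b))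
       & term_of_wot_net (hull_pi H (hat a)) a0]) /\
  (exists b0 : star U X,
     [/\ weak_fin b0, weak_near b0 b, weak_fin (smul a b0),
         bop_comp (hull_pi H (hat a)) (hull_pi H (hat b))
           = hull_pi H (hat (smul a b0))
       & term_of_wot_net (hull_pi H (hat b)) b0]).
Proof.
split.
  apply: (hull_pi_product (@cmul_linearl _ X) (@cmul_linearr _ X)
    (@rnorm_cmul _ X) dual_lt_K K_saturated a_fin b_fin) => xi rho.
  (* Moving y to the other side of the inner product leaves a matrix coefficient
     of b alone. *)
  exists xi, (hull_pi H (hat b) rho); split=> // y e e0.
  have [eta etaP] := bop_adjoint (univ_rep H y) xi.
  have := weakly_tends_clim b_fin (vec_fun eta rho) e0.
  apply: along_sub => t /=; rewrite -hull_piP // -etaP -vec_funE.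
  by rewrite !vec_funE univ_repM !etaP.
have [||x y|xi rho|b0 [? ? ? ? ?]] := hull_pi_product
    (m := fun y x => cmul x y)
    (T := bop_comp (hull_pi H (hat a)) (hull_pi H (hat b)))
    _ _ _ dual_lt_K K_saturated b_fin a_fin.
- exact: cmul_linearr.
- exact: cmul_linearl.
- by rewrite mulrC rnorm_cmul.
  (* Here the limit along a comes first, and the adjoint of its operator turns the
     result into a vector functional of y. *)
- have [eta etaP] := bop_adjoint (hull_pi H (hat a)) xi.
  exists eta, rho; split=> [|y e e0]; first by rewrite /= -etaP.
  have := weakly_tends_clim a_fin (vec_fun xi (univ_rep H y rho)) e0.
  apply: along_sub => t /=; rewrite -hull_piP // etaP !vec_funE.
  by rewrite univ_repM.
by exists b0; split; rewrite // /smul sext2C.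
Qed.
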